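(* (1) Let $d\ge 1$. For all real $h,n$ with $1-\frac{1}{2d}\le h<1$ and $n\ge 1$, the limiting shape of the splitting automaton on $\mathbb{Z}^d$ with parameters $n,h$ is the diamond $\mathbf{D}=\{x\in\mathbb{R}^d:\sum_i|x_i|\le 1\}$, with scaling function $f(t)=\frac1t$. (2) For all real $h,n$ with $\frac{7}{10}\le h<\frac{40}{57}$ and $4-4h\le n\le 16-20h$, the limiting shape of the splitting automaton on $\mathbb{Z}^2$ with parameters $n,h$ is the square $\mathbf{Q}=\{x\in\mathbb{R}^2:\max(|x_1|,|x_2|)\le 1\}$, with scaling function $f(t)=\frac2t$. (3) For all real $h$ with $\frac57\le h<\frac{13}{18}$ and for $n=3$, the limiting shape of the splitting automaton on $\mathbb{Z}^2$ with parameters $n,h$ is the octagon $\mathbf{O}\subset\mathbb{R}^2$ with vertices $(\pm1,0)$, $(0,\pm1)$, $(\pm\frac56,\pm\frac56)$ (all sign choices), with scaling function $f(t)=\frac{5}{3t}$.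
   Context: Splitting automaton on $\mathbb{Z}^d$ with real parameters $n\ge 0$ and $h<1$ (parallel splitting order): the configurations $\eta_t:\mathbb{Z}^d\to\mathbb{R}$, $t=0,1,2,\dots$, are given by $\eta_0(0)=n$, $\eta_0(x)=h$ for $x\ne 0$, and, with $\mathcal{U}_t=\{x:\eta_t(x)\ge 1\}$ and $\mathcal{S}_{t+1}=\mathcal{U}_t$, $$\eta_{t+1}(x)=\eta_t(x)\bigl(1-\mathbf{1}_{x\in\mathcal{S}_{t+1}}\bigr)+\frac{1}{2d}\sum_{y\in\mathcal{S}_{t+1},\,y\sim x}\eta_t(y),$$ where $y\sim x$ means that $x,y$ are nearest neighbours in $\mathbb{Z}^d$. Elements of $\mathcal{S}_{t}$ are the sites that split at time $t$. Let $\mathcal{T}_t=\bigcup_{0<t'\le t}\mathcal{S}_{t'}$ be the set of sites that split at least once until time $t$. Limiting shape: let $\mathbf{C}=\{x\in\mathbb{R}^d:\max_i|x_i|\le\frac12\}$ and, for $\mathcal{V}\subset\mathbb{Z}^d$, $\mathcal{V}+\mathbf{C}=\bigcup_{x\in\mathcal{V}}(x+\mathbf{C})$. Let $\mathbf{S}\subset\mathbb{R}^d$ be a deterministic set scaled such that the maximum of the coordinates $x_i$ over $x\in\mathbf{S}$ and $i$ is $1$. For $\epsilon>0$ let $\mathbf{S}_\epsilon$ be the inner $\epsilon$-neighbourhood of $\mathbf{S}$ (points of $\mathbf{S}$ at distance at least $\epsilon$ from the complement of $\mathbf{S}$) and $\mathbf{S}^\epsilon$ the outer $\epsilon$-neighbourhood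 (points at distance at most $\epsilon$ from $\mathbf{S}$). $\mathbf{S}$ is the limiting shape of a sequence $(\mathcal{V}_t)_{t\ge0}$ of subsets of $\mathbb{Z}^d$, with scaling function $f$, if for every $\epsilon>0$ there is $t^\epsilon$ such that for all $t>t^\epsilon$: $\mathbf{S}_\epsilon\subseteq f(t)(\mathcal{V}_t+\mathbf{C})\subseteq\mathbf{S}^\epsilon$, where $f(t)(\mathcal V_t+\mathbf C)$ is the set $\mathcal V_t+\mathbf C$ scaled by the factor $f(t)$. The limiting shape of the splitting automaton is the limiting shape of $(\mathcal{T}_t)$. *)

(* Defs.v *)
From HB Require Import structures.
From mathcomp Require Import all_boot all_order all_algebra.
From mathcomp Require Import all_classical all_reals all_analysis.

Set Implicit Arguments.
Unset Strict Implicit.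
Unset Printing Implicit Defensive.

Import Order.TTheory GRing.Theory Num.Theory.

Local Open Scope classical_set_scope.
Local Open Scope ring_scope.

Section SplittingAutomaton.
Variables (R : realType) (d : nat).
Implicit Types (eta : 'rV[int]_d -> R) (x y : 'rV[int]_d).

Definition neighbours x : set 'rV[int]_d :=
  [set y | \sum_(i < d) `|x 0 i - y 0 i| = 1].

Definition unstable eta : set 'rV[int]_d := [set x | 1 <= eta x].

(* The summation set has at most 2d elements, so this finitely supported sum
   never takes the default value 0 reserved for infinite supports. *)
Definition split_step (S : set 'rV[int]_d) eta : 'rV[int]_d -> R := fun x =>
  eta x * (1 - \1_S x)
  + 1 / (2 * d)%:R * \sum_(y \in S `&` neighbours x) eta y.

Fixpoint configuration (n h : R) (t : nat) : 'rV[int]_d -> R :=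
  if t is t'.+1 then
    let eta := configuration n h t' in split_step (unstable eta) eta
  else fun x => if x == 0 then n else h.

(* Splittings only take place at times t >= 1; the value at 0 is never used. *)
Definition splitting_sites (n h : R) (t : nat) : set 'rV[int]_d :=
  if t is t'.+1 then unstable (configuration n h t') else set0.

Definition ever_split (n h : R) (t : nat) : set 'rV[int]_d :=
  \bigcup_(s in [set s | (0 < s <= t)%N]) splitting_sites n h s.

End SplittingAutomaton.

Section LimitingShape.
Variables (R : realType) (d : nat).
Implicit Types (x y : 'rV[R]_d) (S : set 'rV[R]_d).

(* Euclidean distance; the library's norm on 'rV[R]_d is the sup norm. *)
Definition euclid_dist x y : R := Num.sqrt (\sum_(i < d) (x 0 i - y 0 i) ^+ 2).

(* Extended-real valued, so that the distance to the empty set is +oo. *)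
Definition dist_to S x : \bar R := ereal_inf [set (euclid_dist x y)%:E | y in S].

Definition inner_nbhd S (eps : R) : set 'rV[R]_d :=
  [set x | S x /\ (eps%:E <= dist_to (~` S) x)%E].

Definition outer_nbhd S (eps : R) : set 'rV[R]_d :=
  [set x | (dist_to S x <= eps%:E)%E].

Definition unit_cube : set 'rV[R]_d :=
  [set x | forall i : 'I_d, `|x 0 i| <= 1 / 2].

Definition cubify (V : set 'rV[int]_d) : set 'rV[R]_d :=
  [set map_mx intr v + c | v in V & c in unit_cube].

Definition unit_scaled S : Prop :=
  (forall x (i : 'I_d), S x -> x 0 i <= 1)
  /\ (exists x (i : 'I_d), S x /\ x 0 i = 1).

Definition limiting_shape (V : nat -> set 'rV[int]_d) (f : nat -> R) S : Prop :=
  unit_scaled S /\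
  forall eps : R, 0 < eps ->
    exists t_eps : nat, forall t : nat, (t_eps < t)%N ->
      inner_nbhd S eps `<=` [set f t *: x | x in cubify (V t)]
      /\ [set f t *: x | x in cubify (V t)] `<=` outer_nbhd S eps.

Definition automaton_limiting_shape (n h : R) (f : nat -> R) S : Prop :=
  limiting_shape (ever_split n h) f S.

End LimitingShape.

Section Shapes.
Variable R : realType.

Definition diamond (d : nat) : set 'rV[R]_d :=
  [set x | \sum_(i < d) `|x 0 i| <= 1].

Definition square : set 'rV[R]_2 :=
  [set x | Num.max `|x 0 0| `|x 0 1| <= 1].

Definition point2 (a b : R) : 'rV[R]_2 := \row_j [:: a; b]`_j.

Definition octagon_vertices : set 'rV[R]_2 :=
  [set point2 1 0; point2 (-1) 0; point2 0 1; point2 0 (-1);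
       point2 (5 / 6) (5 / 6); point2 (5 / 6) (- (5 / 6));
       point2 (- (5 / 6)) (5 / 6); point2 (- (5 / 6)) (- (5 / 6))].

Definition convex_hull (A : set 'rV[R]_2) : set 'rV[R]_2 :=
  smallest (fun B : set 'rV[R]_2 => @convex_set R 'rV[R]_2 B) A.

(* The eight points are in convex position, so the octagon with these vertices
   is their convex hull. *)
Definition octagon : set 'rV[R]_2 := convex_hull octagon_vertices.

End Shapes.

Arguments diamond R d : clear implicits.
Arguments square R : clear implicits.
Arguments octagon R : clear implicits.

(* Main.v *)
Require Import Defs.
From HB Require Import structures.
From mathcomp Require Import all_boot all_order all_algebra.
From mathcomp Require Import all_classical all_reals all_analysis.
From mathcomp Require Import zify ring lra.

Set Implicit Arguments.
Unset Strict Implicit.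
Unset Printing Implicit Defensive.

Import Order.TTheory GRing.Theory Num.Theory.

Local Open Scope classical_set_scope.
Local Open Scope ring_scope.

(** Everything reduces to knowing, up to a bounded error, when each site splits
    for the first time. If [N] is a sublinear gauge on R^d, and the set of sites
    split by time [t] contains the lattice points with [N v <= a t - b] and is
    contained in those with [N v <= a t + b], then rescaling by [1 / (a t)] makes
    the errors vanish and the limiting shape is the unit ball of [N]
    ([limiting_shape_gauge]). The diamond, the square and the octagon are the
    unit balls of the l1 norm, of the sup norm, and of
    [max (|x0| + |x1| / 5) (|x1| + |x0| / 5)].

    Diamond. A site that splits gives at least [1 / (2d)] to each neighbour, and
    with [h >= 1 - 1 / (2d)] this is all that an untouched site needs. Hence the
    front advances by one unit of l1 distance per step; it cannot advance faster,
    because a site only changes when a neighbour splits.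

    In the plane two facts tame the dynamics. A site with [t + x + y] odd is
    stable at time [t] ([off_parity_stable]), so that a site which has just split
    is empty and receives nothing at that step. Moreover the configuration is
    invariant under the symmetries of the lattice, so it is enough to follow it
    on the octant [0 <= x <= y], where it is a travelling wave: up to bounded
    intervals and up to finitely many types of site (on the axis, near or on the
    diagonal, elsewhere), the value at [(x, y)] at time [t] depends only on a
    phase, an integer linear function of [t], [x] and [y]. The records
    [even_profile], [odd_profile] and [wave] list these intervals, and each is
    shown to be preserved by one step of the automaton by interval arithmetic.

    Square. The phase is [t - 2y]: the horizontal line at height [y] is invaded at
    two consecutive times, first at the sites of one parity and then at those of
    the other, which explains the speed [1/2]. The sites of the first kind must
    not push the next line over the threshold, and those of the second kind must;
    the values [4 - 4h] and [16 - 20h] separate the two behaviours. Behind the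
    front nothing precise is known, but a site never holds more than [8]
    ([configuration_bounded]); each line between a deep site and the front divides
    its influence by four, and a few lines suffice. When [n = 16 - 20h] the site
    [(0, 2)] reaches exactly [1] at time 2, and the wave runs one step earlier,
    with different corners; hence the two profiles.

    Octagon. The phase is [3t - 5y - x], whose level lines have the slope of a
    side of the octagon. A site is unstable exactly when its phase is even and at
    least [-4] ([wave_untouched], [wave_unstable]): behind the front the
    configuration is a checkerboard of unstable and empty sites. *)

(** * One splitting step as a recurrence *)

Section Emission.
Variable R : realType.
Implicit Types v b : R.

(** The update of a site involves a value [v] only through the mass it sends away
    and the mass it keeps. *)
Definition emitted v : R := if 1 <= v then v else 0.
Definition kept v : R := if 1 <= v then 0 else v.

Lemma emitted_ge0 v : 0 <= emitted v.
Proof. by rewrite /emitted; case: ifP => // /(le_trans ler01). Qed.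

Lemma emitted_stable v : v < 1 -> emitted v = 0.
Proof. by rewrite /emitted ltNge => /negbTE ->. Qed.

Lemma emitted_unstable v : 1 <= v -> emitted v = v.
Proof. by rewrite /emitted => ->. Qed.

Lemma kept_stable v : v < 1 -> kept v = v.
Proof. by rewrite /kept ltNge => /negbTE ->. Qed.

Lemma kept_unstable v : 1 <= v -> kept v = 0.
Proof. by rewrite /kept => ->. Qed.

Lemma kept_lt1 v : kept v < 1.
Proof. by rewrite /kept; case: (lerP 1 v) => // _; exact: ltr01. Qed.

Lemma emitted_le v b : 0 <= b -> v <= b -> emitted v <= b.
Proof. by rewrite /emitted; case: ifP. Qed.

End Emission.

Section Neighbours.
Variable d : nat.
Implicit Types (x y : 'rV[int]_d) (p : 'I_d * bool).

Definition nbr x p : 'rV[int]_d := x + (-1) ^+ p.2 *: delta_mx 0 p.1.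

Lemma nbr_inj x : injective (nbr x).
Proof.
move=> [i b] [j c] /addrI /rowP /= e; have := e i; have := e j.
rewrite !mxE !eqxx /=; have [->|ne] := eqVneq i j.
  by case: b c {e} => -[].
by case: b c {e} => -[].
Qed.

Lemma neighbours_nbr x : neighbours x = [set` [seq nbr x p | p : 'I_d * bool]].
Proof.
apply/seteqP; split => [y /= xy1|y /= /mapP[[i b] _ ->]]; last first.
  rewrite /neighbours /= (bigD1 i) //= big1 => [|j ji].
    by rewrite !mxE !eqxx /=; case: b; rewrite /=; lia.
  by rewrite !mxE (negbTE ji) andbF /=; lia.
have [i xyi|xy0] := pickP (fun i => x 0 i != y 0 i); last first.
  move: xy1; rewrite /neighbours /= big1 // => i _.
  by move: (xy0 i) => /eqP ->; rewrite subrr normr0.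
have rest0 : forall j, j != i -> x 0 j = y 0 j.
  move: xy1; rewrite /neighbours /= (bigD1 i) //= => xy1 j ji.
  have s0 : \sum_(k < d | k != i) `|x 0 k - y 0 k| = 0.
    have : 0 <= \sum_(k < d | k != i) `|x 0 k - y 0 k| by apply: sumr_ge0.
    by move: xyi xy1; set s := \sum_(_ < _ | _) _ => ? ? ?; lia.
  move/eqP: s0; rewrite psumr_eq0 // => /allP /(_ j).
  by rewrite mem_index_enum ji => /(_ isT) /=; lia.
have xyi1 : `|x 0 i - y 0 i| = 1.
  move: xy1; rewrite /neighbours /= (bigD1 i) //= big1 ?addr0 // => j ji.
  by rewrite rest0 // subrr normr0.
apply/mapP; exists (i, x 0 i > y 0 i); first by rewrite mem_enum.
apply/rowP => j; rewrite !mxE /=; have [->|ji] := eqVneq j i.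
  by case: (ltrP (y 0 i) (x 0 i)) => ? /=; lia.
by rewrite rest0 //= mulr0 addr0.
Qed.

Lemma nbr_same x p j : j != p.1 -> nbr x p 0 j = x 0 j.
Proof. by move=> ji; rewrite !mxE (negbTE ji) andbF mulr0 addr0. Qed.

Lemma nbr_moved x p : nbr x p 0 p.1 = x 0 p.1 + (-1) ^+ p.2.
Proof. by rewrite !mxE !eqxx mulr1. Qed.

End Neighbours.

Section Step.
Variables (R : realType) (d : nat).
Implicit Types (eta : 'rV[int]_d -> R) (x : 'rV[int]_d).

(** Replaces the finitely supported sum over a set by a sum over the finite type of
    signed directions, which is what every later computation unfolds. *)
Lemma split_stepE eta x :
  split_step (unstable eta) eta x =
  kept (eta x) + 1 / (2 * d)%:R * \sum_p emitted (eta (nbr x p)).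
Proof.
rewrite /split_step; congr (_ + _ * _).
  rewrite /kept indicE; have [xS|xS] := boolP (1 <= eta x).
    by rewrite mem_set //= subrr mulr0.
  by rewrite memNset /= ?subr0 ?mulr1 //; apply/negP.
rewrite neighbours_nbr fsbig_mkcondl -fsbig_seq; last first.
  by rewrite map_inj_uniq ?enum_uniq //; exact: nbr_inj.
rewrite big_map big_enum; apply: eq_bigr => p _ /=.
rewrite /emitted; have [xS|xS] := boolP (1 <= _); first by rewrite mem_set.
by rewrite memNset //; apply/negP.
Qed.

End Step.

Lemma ever_splitP (R : realType) d (n h : R) t (v : 'rV[int]_d) :
  ever_split n h t v <->
  exists2 s, (s < t)%N & 1 <= configuration n h s v.
Proof.
split=> [[[|s] //= st sv]|[s st sv]]; first by exists s.
by exists s.+1.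
Qed.

(** * Balls of a gauge as limiting shapes *)

Section Gauge.
Variables (R : realType) (d : nat).
Implicit Types (x y : 'rV[R]_d) (N : 'rV[R]_d -> R).

Lemma sqrt_sumsq_le (a : 'I_d -> R) :
  Num.sqrt (\sum_i a i ^+ 2) <= \sum_i `|a i|.
Proof.
have [le0 ge0] : \sum_i a i ^+ 2 <= (\sum_i `|a i|) ^+ 2 /\ 0 <= \sum_i `|a i|.
  elim/big_rec2: _ => [|i p q _ [pq p0]]; first by rewrite expr0n.
  split; last by rewrite addr_ge0.
  rewrite sqrrD -(real_normK (num_real (a i))) -addrA lerD2l.
  by apply: ler_wpDl => //; rewrite mulrn_wge0 // mulr_ge0.
by rewrite -[leRHS]ger0_norm // -sqrtr_sqr ler_wsqrtr.
Qed.

(** Moving a point radially by a factor [s] costs a Euclidean distance controlled by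
    its gauge; both halves of the limiting shape compare a point with a multiple of
    itself. *)
Lemma euclid_dist_scale N x (s : R) : (forall (z : 'rV[R]_d) i, `|z 0 i| <= N z) ->
  euclid_dist x (s *: x) <= `|1 - s| * d%:R * N x.
Proof.
move=> coordN; apply: (le_trans (sqrt_sumsq_le _)).
have -> : `|1 - s| * d%:R * N x = \sum_(i < d) (`|1 - s| * N x).
  by rewrite sumr_const card_ord -[RHS]mulr_natr mulrAC.
apply: ler_sum => i _; rewrite !mxE -{1}[x 0 i]mul1r -mulrBl normrM.
by rewrite ler_wpM2l.
Qed.

Lemma near_integer_point x :
  exists v : 'rV[int]_d, unit_cube (x - map_mx intr v).
Proof.
exists (\row_i Num.floor (x 0 i + 1 / 2)) => i; rewrite !mxE.
have := floor_itv (x 0 i + 1 / 2); rewrite intrD => /andP[? ?].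
by rewrite ler_norml; apply/andP; split; lra.
Qed.

Lemma unit_cubeN x : unit_cube x -> unit_cube (- x).
Proof. by move=> cx i; rewrite !mxE normrN. Qed.

(** Outer inclusion: a rescaled point has gauge at most [1 + O(1/t)], and dividing it
    by this quantity gives a nearby point of the ball. Inner inclusion: a point at
    distance at least [eps] from the complement has gauge bounded away from 1, since
    otherwise a slight dilation would leave the ball; there is then room for
    rounding its multiple [a t y] to a lattice point. *)
Lemma limiting_shape_gauge N (a b C : R) (V : nat -> set 'rV[int]_d)
    (f : nat -> R) :
  0 < a -> 0 <= b -> 0 <= C ->
  (forall s x, 0 <= s -> N (s *: x) = s * N x) ->
  (forall x y, N (x + y) <= N x + N y) ->
  (forall x (i : 'I_d), `|x 0 i| <= N x) ->
  (forall c, unit_cube c -> N c <= C) ->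
  (exists x (i : 'I_d), N x <= 1 /\ x 0 i = 1) ->
  (forall t v, (0 < t)%N -> V t v -> N (map_mx intr v) <= a * t%:R + b) ->
  (forall t v, (0 < t)%N -> N (map_mx intr v) <= a * t%:R - b -> V t v) ->
  (forall t, (0 < t)%N -> f t = (a * t%:R)^-1) ->
  limiting_shape V f [set x | N x <= 1].
Proof.
move=> a0 b0 C0 scN addN coordN cubeN [x1 [i1 [Nx1 x1i]]] VN NV fE.
have N0 x : 0 <= N x := le_trans (normr_ge0 _) (coordN x i1).
have d0 : 0 < d%:R :> R by rewrite ltr0n (leq_trans _ (ltn_ord i1)).
split.
  split; first by move=> x i /= Nx; rewrite (le_trans (ler_norm _)) ?(le_trans (coordN _ _)).
  by exists x1, i1.
move=> eps eps0.
(* The dilation by [g] moves a point of the ball by less than [eps]. *)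
pose g : R := 1 + eps / (d%:R + 1).
have g1 : 1 < g by rewrite /g ltrDl divr_gt0 //; lra.
have gV1 : 0 < 1 - g^-1 by rewrite subr_gt0 invf_lt1 //; lra.
(* The two terms are what the inner and the outer inclusion require of [t]. *)
pose T : R := (b + C) / (a * (1 - g^-1)) + d%:R * (b + C) / (a * eps).
have T10 : 0 <= (b + C) / (a * (1 - g^-1)).
  by apply: divr_ge0; rewrite ?addr_ge0 // mulr_ge0 //; lra.
have T20 : 0 <= d%:R * (b + C) / (a * eps).
  by apply: divr_ge0; apply: mulr_ge0; rewrite ?addr_ge0 //; lra.
exists (Num.bound T) => t tT.
have Tt : T <= t%:R.
  apply: ltW; apply: (lt_trans (archi_boundP _)); first by rewrite addr_ge0.
  by rewrite ltr_nat.
have t0 : (0 < t)%N by case: t tT {Tt}.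
have at0 : 0 < a * t%:R by rewrite mulr_gt0 // ltr0n.
split=> [y [/= Ny1 epsy]|_ [_ [v Vv [c cc <-]] <-]] /=.
- have Nyg : N y <= g^-1.
    rewrite leNgt; apply/negP => gNy.
    have : (eps%:E <= (euclid_dist y (g *: y))%:E)%E.
      apply: (le_trans epsy); apply: ereal_inf_lbound; exists (g *: y) => //=.
      rewrite scN; last by lra.
      apply/negP; rewrite -ltNge.
      by rewrite -ltr_pdivrMl ?mulr1 //; lra.
    rewrite lee_fin; apply/negP; rewrite -ltNge.
    apply: (le_lt_trans (euclid_dist_scale y g coordN)).
    rewrite ler0_norm; last by lra.
    have -> : - (1 - g) = eps / (d%:R + 1) by rewrite /g; ring.
    apply: (@le_lt_trans _ _ (eps / (d%:R + 1) * d%:R)).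
      by rewrite ler_piMr // mulr_ge0 ?divr_ge0 //; lra.
    by rewrite mulrAC ltr_pdivrMr ?ltr_pM2l; lra.
  have [v cv] := near_integer_point ((a * t%:R) *: y).
  exists ((a * t%:R) *: y); last by rewrite fE // scalerA mulVf ?scale1r ?gt_eqF.
  exists v; last by exists ((a * t%:R) *: y - map_mx intr v) => //; rewrite addrC subrK.
  apply: NV => //.
  have -> : map_mx intr v = (a * t%:R) *: y + - ((a * t%:R) *: y - map_mx intr v) :> 'rV[R]_d.
    by rewrite opprB addrC subrK.
  apply: (le_trans (addN _ _)); rewrite scN; last exact: ltW.
  have := cubeN _ (unit_cubeN cv).
  set n1 := N (- _) => n1C.
  have : a * t%:R * N y <= a * t%:R * g^-1 by rewrite ler_pM2l.
  have : (b + C) <= t%:R * (a * (1 - g^-1)).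
    rewrite -ler_pdivrMr ?mulr_gt0 //; apply: le_trans Tt; rewrite /T; lra.
  by move: g^-1 => gV; nra.
rewrite fE //; set y := _ *: _.
have Ny : N y <= 1 + (b + C) / (a * t%:R).
  rewrite /y scN; last by rewrite invr_ge0 ltW.
  rewrite mulrC ler_pdivrMr // mulrDl mul1r divfK ?gt_eqF //.
  apply: (le_trans (addN _ _)); have := VN _ _ t0 Vv; have := cubeN _ cc; lra.
set k := 1 + _ in Ny.
have k1 : 1 <= k by rewrite /k lerDl divr_ge0 ?addr_ge0 // ltW.
apply: (@le_trans _ _ (euclid_dist y (k^-1 *: y))%:E).
  apply: ereal_inf_lbound; exists (k^-1 *: y) => //=.
  rewrite scN; last by rewrite invr_ge0; lra.
  by rewrite mulrC ler_pdivrMr ?mul1r //; lra.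
rewrite lee_fin; apply: (le_trans (euclid_dist_scale y _ coordN)).
rewrite ger0_norm; last by rewrite subr_ge0 invf_le1; lra.
apply: (@le_trans _ _ ((1 - k^-1) * d%:R * k)).
  by rewrite ler_wpM2l // mulr_ge0 ?subr_ge0 ?invf_le1 //; lra.
have -> : (1 - k^-1) * d%:R * k = d%:R * (b + C) / (a * t%:R).
  rewrite mulrAC mulrBl mulVf ?mul1r; last by lra.
  by rewrite /k; field; rewrite (gt_eqF a0) pnatr_eq0 -lt0n t0.
rewrite ler_pdivrMr //.
have : d%:R * (b + C) / (a * eps) <= t%:R by apply: le_trans Tt; rewrite /T lerDr.
rewrite ler_pdivrMr ?mulr_gt0 //.
by have -> : t%:R * (a * eps) = eps * (a * t%:R) by ring.
Qed.

End Gauge.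

(** * The l1 distance and the diamond *)

Section Diamond.
Variables (R : realType) (d : nat).
Implicit Types (x : 'rV[int]_d) (p : 'I_d * bool).

Definition l1 x : nat := (\sum_i `|x 0%R i|)%N.

Lemma l1_nbr x p : (l1 x <= (l1 (nbr x p)).+1)%N.
Proof.
rewrite /l1 (bigD1 p.1) //= [X in (_ <= X.+1)%N](bigD1 p.1) //= nbr_moved.
rewrite (eq_bigr (fun j => `|nbr x p 0%R j|%N)) => [|j ji]; last by rewrite nbr_same.
by case: p.2 => /=; lia.
Qed.

Lemma l1_closer_nbr x : (0 < l1 x)%N -> exists p, l1 x = (l1 (nbr x p)).+1.
Proof.
move=> x0; have [i xi|allx0] := pickP (fun i => x 0 i != 0); last first.
  by move: x0; rewrite /l1 big1 // => i _; move/eqP: (allx0 i) => ->.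
pose p := (i, 0 < x 0 i); exists p; rewrite /l1 (bigD1 i) //= [in RHS](bigD1 i) //=.
rewrite (eq_bigr (fun j => `|nbr x p 0%R j|%N)) => [|j ji]; last first.
  by rewrite nbr_same.
by rewrite (nbr_moved x p) /p /=; case: ltP => /= ?; lia.
Qed.

Lemma l1_eq0 x : (l1 x == 0%N) = (x == 0).
Proof.
apply/eqP/eqP => [/eqP|->]; last by rewrite /l1 big1 // => i _; rewrite mxE.
rewrite /l1 sum_nat_eq0 => /forallP x0; apply/rowP => i.
by rewrite mxE; apply/eqP; rewrite -absz_eq0; have := x0 i.
Qed.

Section Front.
Variables (n h : R).
Hypothesis h1 : h < 1.

(** Mass travels one lattice step per unit of time. *)
Lemma untouched_outside t x : (t < l1 x)%N -> configuration n h t x = h.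
Proof.
elim: t x => [|t IH] x tx /=; first by rewrite -l1_eq0 gtn_eqF.
rewrite split_stepE IH ?(ltn_trans _ tx) // kept_stable // big1 ?mulr0 ?addr0 //.
move=> p _; rewrite IH ?emitted_stable //.
by have := l1_nbr x p; lia.
Qed.

(** The one neighbour that is closer to the origin splits at the right time and its
    contribution alone brings the site from [h] to the threshold. *)
Lemma unstable_on_front t x : 1 - 1 / (2 * d)%:R <= h -> 1 <= n ->
  l1 x = t -> 1 <= configuration n h t x.
Proof.
move=> hd n1; elim: t x => [|t IH] x xt; first by rewrite /= -l1_eq0 xt eqxx.
rewrite /= split_stepE untouched_outside ?xt // kept_stable //.
have [p xp] := @l1_closer_nbr x ltac:(by rewrite xt).
have yp := IH (nbr x p) ltac:(lia).
apply: (@le_trans _ _ (h + 1 / (2 * d)%:R * 1)); first by rewrite mulr1; lra.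
rewrite lerD2l ler_wpM2l ?divr_ge0 // (bigD1 p) //= emitted_unstable //.
by apply: ler_wpDr => //; apply: sumr_ge0 => q _; exact: emitted_ge0.
Qed.

End Front.

Lemma diamond_limiting_shape (n h : R) : (1 <= d)%N ->
  1 - 1 / (2 * d)%:R <= h -> h < 1 -> 1 <= n ->
  automaton_limiting_shape n h (fun t : nat => 1 / t%:R) (diamond R d).
Proof.
move=> d1 hd h1 n1.
have NE (v : 'rV[int]_d) :
    \sum_i `|(map_mx intr v : 'rV[R]_d) 0 i| = (l1 v)%:R.
  rewrite /l1 natr_sum; apply: eq_bigr => i _.
  by rewrite mxE natr_absz -intr_norm.
rewrite /automaton_limiting_shape /diamond.
apply: (@limiting_shape_gauge R d (fun x : 'rV[R]_d => \sum_i `|x 0 i|) 1 1 d%:R) => //.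
- move=> s x s0; rewrite mulr_sumr; apply: eq_bigr => i _.
  by rewrite mxE normrM ger0_norm.
- move=> x y; rewrite -big_split /=; apply: ler_sum => i _.
  by rewrite mxE ler_normD.
- by move=> x i; rewrite (bigD1 i) //= lerDl; apply: sumr_ge0.
- move=> c cc; apply: (@le_trans _ _ (\sum_(i < d) 1)).
    by apply: ler_sum => i _; apply: le_trans (cc i) _; lra.
  by rewrite sumr_const card_ord.
- exists (delta_mx 0 (Ordinal d1)), (Ordinal d1); rewrite mxE !eqxx; split => //.
  rewrite (bigD1 (Ordinal d1)) //= big1 => [|j jo]; rewrite mxE ?eqxx ?normr1 ?addr0 //.
  by rewrite (negbTE jo) andbF normr0.
- move=> t v t0 /ever_splitP[s st sv]; rewrite NE mul1r.
  have : (l1 v <= s)%N.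
    rewrite leqNgt; apply/negP => /(untouched_outside n h1) E.
    by move: sv; rewrite E leNgt h1.
  move=> vs; have : (l1 v <= t)%N by lia.
  by rewrite -(ler_nat R); lra.
- move=> t v t0; rewrite NE mul1r => vt; apply/ever_splitP; exists (l1 v).
    have : (l1 v).+1%:R <= t%:R :> R by rewrite -natr1; lra.
    by rewrite ler_nat.
  exact: unstable_on_front.
- by move=> t _ /=; rewrite !mul1r.
Qed.

End Diamond.

(** * Parity and a uniform bound *)

Section Parity.
Variables (R : realType) (d : nat) (n h : R).
Implicit Types (x : 'rV[int]_d) (p : 'I_d * bool).

Lemma odd_l1_nbr x p : odd (l1 (nbr x p)) = ~~ odd (l1 x).
Proof.
rewrite /l1 (bigD1 p.1) //= [in RHS](bigD1 p.1) //= nbr_moved.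
rewrite (eq_bigr (fun j => `|x 0%R j|%N)) => [|j ji]; last by rewrite nbr_same.
by case: p.2 => /=; lia.
Qed.

Lemma nbrK x p : nbr (nbr x p) (p.1, ~~ p.2) = x.
Proof.
by rewrite /nbr -addrA -scalerDl; case: p.2; rewrite /= ?addNr ?subrr scale0r addr0.
Qed.

(** A site can only become unstable by receiving mass, hence one step after a
    neighbour was unstable; as the origin starts the process, parity is preserved. *)
Lemma off_parity_stable t x : h < 1 -> odd (t + l1 x) ->
  configuration n h t x < 1.
Proof.
move=> h1; elim: t x => [|t IH] x tx /=.
  by rewrite -l1_eq0; case: eqP tx => // ->.
rewrite split_stepE big1 ?mulr0 ?addr0 ?kept_lt1 // => p _.
by rewrite emitted_stable // IH // oddD odd_l1_nbr; move: tx; rewrite /= oddD; case: odd.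
Qed.

Lemma empty_after_split t x : h < 1 -> 1 <= configuration n h t x ->
  configuration n h t.+1 x = 0.
Proof.
move=> h1 x1; rewrite /= split_stepE kept_unstable // big1 ?mulr0 ?addr0 // => p _.
rewrite emitted_stable // off_parity_stable //.
rewrite oddD odd_l1_nbr; apply/negPn/negP => tx.
have : odd (t + l1 x) by rewrite oddD; move: tx; do 2!case: odd.
by move=> /(off_parity_stable h1); rewrite ltNge x1.
Qed.

(** The naive estimate, what is kept plus an average over the neighbours, grows by 1
    at each step. But if a site keeps a nonzero amount, then it did not split at the
    previous step, so its neighbours received from at most [2d - 1] sites and are
    bounded by [1 + (2d - 1) / (2d) * 4d = 4d - 1]: this is the second half of the
    induction hypothesis. *)
Lemma configuration_bounded t x : (1 <= d)%N -> h < 1 -> n <= (4 * d)%:R - 1 ->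
  configuration n h t x <= (4 * d)%:R.
Proof.
move=> d1 h1 nd.
have d1R : 1 <= d%:R :> R by rewrite ler1n.
have dE : (4 * d)%:R = 4 * d%:R :> R by rewrite natrM.
have wE : 1 / (2 * d)%:R = (2 * d%:R)^-1 :> R by rewrite natrM div1r.
have sumE (c : R) : \sum_(p : 'I_d * bool) c = 2 * d%:R * c.
  rewrite sumr_const card_prod card_ord card_bool -[LHS]mulr_natl natrM.
  by rewrite (mulrC d%:R).
have mulw (c : R) : (2 * d%:R)^-1 * (2 * d%:R * c) = c.
  by rewrite mulKf // mulf_neq0 //; lra.
suff [] : configuration n h t x <= 4 * d%:R /\
    (configuration n h t x < 1 -> configuration n h t x != 0 ->
     forall p, configuration n h t (nbr x p) <= 4 * d%:R - 1) by rewrite dE.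
rewrite dE in nd.
elim: t x => [|t IH] x.
  by split=> [|_ _ p] /=; case: eqP => _; lra.
have le4d (y : 'rV[int]_d) : emitted (configuration n h t y) <= 4 * d%:R.
  by apply: emitted_le; [lra | have [] := IH y].
split=> [|x1 x0 p].
  rewrite /= split_stepE wE.
  have [x1|x1] := lerP 1 (configuration n h t x).
    rewrite kept_unstable // add0r -[leRHS]mulw -sumE.
    by rewrite ler_wpM2l ?invr_ge0 ?ler_sum //; lra.
  have [x0|x0] := eqVneq (configuration n h t x) 0.
    rewrite x0 kept_stable ?ltr01 // add0r -[leRHS]mulw -sumE.
    by rewrite ler_wpM2l ?invr_ge0 ?ler_sum //; lra.
  have [_ /(_ x1 x0) nb] := IH x.
  have : (2 * d%:R)^-1 * (\sum_p emitted (configuration n h t (nbr x p)))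
      <= 4 * d%:R - 1.
    rewrite -[leRHS]mulw -sumE ler_wpM2l ?invr_ge0 ?mulr_ge0 //.
    by apply: ler_sum => p _; apply: emitted_le => //; lra.
  by rewrite kept_stable //; lra.
have x1t : configuration n h t x < 1.
  by rewrite ltNge; apply/negP => /(empty_after_split h1) /eqP; rewrite (negbTE x0).
rewrite /= split_stepE wE.
have : (2 * d%:R)^-1 * (\sum_q emitted (configuration n h t (nbr (nbr x p) q)))
    <= 4 * d%:R - 2.
  rewrite (bigD1 (p.1, ~~ p.2)) //= nbrK (emitted_stable x1t) add0r.
  have -> : 4 * d%:R - 2 = (2 * d%:R)^-1 * (2 * d%:R * (4 * d%:R) - 4 * d%:R) :> R.
    by rewrite mulrBr mulw; field; lra.
  rewrite ler_wpM2l ?invr_ge0 ?mulr_ge0 //.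
  rewrite -sumE [in leRHS](bigD1 (p.1, ~~ p.2)) //= addrAC subrr add0r.
  by apply: ler_sum => q _.
by have := kept_lt1 (configuration n h t (nbr x p)); lra.
Qed.

End Parity.

(** * Folding the plane onto an octant *)

Section Quadrant.
Variables (R : realType) (n h : R).
Implicit Types t x y : nat.

(** On absolute values, the two neighbours of a coordinate [x] are [x + 1] and [back x]:
    both neighbours of 0 have absolute value 1. *)
Definition back x := if x is x'.+1 then x' else 1%N.

Lemma backP x : x = 0%N /\ back x = 1%N \/ x = (back x).+1.
Proof. by case: x => [|x]; [left | right]. Qed.

Fixpoint quadrant t x y : R :=
  if t is s.+1 then
    kept (quadrant s x y)
    + (emitted (quadrant s x.+1 y) + emitted (quadrant s (back x) y)
       + emitted (quadrant s x y.+1) + emitted (quadrant s x (back y))) / 4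
  else if (x == 0%N) && (y == 0%N) then n else h.

(** Folding by the reflections is compatible with the dynamics because the initial
    configuration is symmetric; this replaces integers by natural numbers. *)
Lemma configuration_quadrant t (v : 'rV[int]_2) :
  configuration n h t v = quadrant t `|v 0 0| `|v 0 1|.
Proof.
elim: t v => [|t IH] v /=.
  congr (if _ then _ else _); rewrite !absz_eq0; apply/eqP/andP => [->|].
    by rewrite !mxE.
  move=> [/eqP v0 /eqP v1]; apply/rowP => i; rewrite mxE.
  case: (unliftP ord0 i) => [j ->|->] //; rewrite (ord1 j) -v1.
  by congr (v _ _); apply: val_inj.
rewrite split_stepE IH; congr (_ + _).
rewrite (eq_bigr (fun p => emitted (configuration n h t (nbr v (p.1, p.2))))); last by case.
rewrite -(pair_bigA _ (fun i b => emitted (configuration n h t (nbr v (i, b))))) /=.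
have fold (a : int) (F : nat -> R) :
    F (absz (a + (-1) ^+ true)) + F (absz (a + (-1) ^+ false))
      = F (absz a).+1 + F (back (absz a)).
  case: a => [[|k]|k] //=.
  - by rewrite addrC; congr (F _ + F _); lia.
  - by congr (F _ + F _); lia.
rewrite !big_ord_recl big_ord0 addr0 !big_bool /=.
rewrite !IH.
have e01 : lift ord0 ord0 = 1 :> 'I_2 by apply: val_inj.
rewrite e01.
have n00 b : nbr v (0, b) 0 0 = v 0 0 + (-1) ^+ b by rewrite (nbr_moved v (0, b)).
have n01 b : nbr v (0, b) 0 1 = v 0 1 by rewrite (nbr_same v).
have n10 b : nbr v (1, b) 0 0 = v 0 0 by rewrite (nbr_same v).
have n11 b : nbr v (1, b) 0 1 = v 0 1 + (-1) ^+ b by rewrite (nbr_moved v (1, b)).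
rewrite !n00 !n01 !n10 !n11.
rewrite (fold _ (fun k => emitted (quadrant t k _))).
rewrite (fold _ (fun k => emitted (quadrant t _ k))).
by rewrite mulrC div1r addrA.
Qed.

Lemma quadrant_configuration x y :
  exists2 v : 'rV[int]_2, l1 v = (x + y)%N
    & forall t, quadrant t x y = configuration n h t v.
Proof.
exists (\row_j (if j == 0 then x%:Z else y%:Z)) => [|t].
  by rewrite /l1 !big_ord_recl big_ord0 !mxE /= addn0.
by rewrite configuration_quadrant !mxE.
Qed.

Lemma quadrantC t x y : quadrant t x y = quadrant t y x.
Proof.
elim: t x y => [|t IH] x y /=; first by rewrite andbC.
rewrite (IH x y) (IH x.+1) (IH (back x)) (IH x y.+1) (IH x (back y)).
by congr (_ + _ / _); ring.
Qed.

Hypothesis h1 : h < 1.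

Lemma quadrant_off_parity t x y : odd (t + x + y) -> quadrant t x y < 1.
Proof.
have [v vE ->] := quadrant_configuration x y.
by rewrite -addnA -vE; exact: off_parity_stable.
Qed.

Lemma quadrant_off_parity_step t x y : odd (t.+1 + x + y) ->
  quadrant t.+1 x y = kept (quadrant t x y).
Proof.
move=> oxy /=; rewrite !emitted_stable ?addr0 ?mul0r ?addr0 //;
  apply: quadrant_off_parity; have := backP x; have := backP y; lia.
Qed.

Lemma quadrant_after_split t x y :
  1 <= quadrant t x y -> quadrant t.+1 x y = 0.
Proof.
have [v _ E] := quadrant_configuration x y.
by rewrite !E; exact: empty_after_split.
Qed.

Lemma quadrant_le8 t x y : n <= 7 -> quadrant t x y <= 8.
Proof.
move=> n7; have [v _ ->] := quadrant_configuration x y.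
by apply: (@configuration_bounded R 2 n h t v) => //=; lra.
Qed.

(** Reading the recurrence only on the octant [x <= y]: across the diagonal the
    missing neighbours are the mirror images of those inside. *)
Lemma quadrant_inside t x y : (x < y)%N -> quadrant t.+1 x y =
  kept (quadrant t x y)
  + (emitted (quadrant t x.+1 y) + emitted (quadrant t (back x) y)
     + emitted (quadrant t x y.+1) + emitted (quadrant t x y.-1)) / 4.
Proof. by case: y. Qed.

Lemma quadrant_diagonal t y : (0 < y)%N -> quadrant t.+1 y y =
  kept (quadrant t y y)
  + (emitted (quadrant t y y.+1) + emitted (quadrant t y.-1 y)) / 2.
Proof.
case: y => // y _ /=.
by rewrite (quadrantC _ _.+2) (quadrantC _ y.+1 y); congr (_ + _); field.
Qed.

Lemma quadrant_origin t : quadrant t.+1 0 0 =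
  kept (quadrant t 0 0) + emitted (quadrant t 0 1).
Proof. by rewrite /= (quadrantC _ 1); congr (_ + _); field. Qed.

End Quadrant.

(* Integer side conditions, with the hypotheses on reals out of the way. *)
Ltac arith := repeat match goal with
  | H : context [@Order.le] |- _ => clear H
  | H : context [@Order.lt] |- _ => clear H
  | H : context [@quadrant] |- _ => clear H
  end; lia.

(** * The square when [n < 16 - 20h] *)

Section SquareEvenPhase.
Variables (R : realType) (n h : R).
Hypotheses (h_lo : 7 / 10 <= h) (h_hi : h < 40 / 57).
Hypotheses (n_lo : 4 - 4 * h <= n) (n_hi : n < 16 - 20 * h).
Implicit Types t x y : nat.
Local Notation c := (quadrant n h).

(** The sites [x <= y] of the line at height [y], at phase [t - 2y]. The line is loaded
    at phases -2 and -1, invaded at phases -1 ([even_first]) and 0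
    ([even_second]), and then alternates between holes and quiet sites; [even_inner3]
    and [even_inner4] are the crude bounds of the interior. An entry below [4 - 4h]
    does not raise its outer neighbour from [h] to 1, an entry of at least [4 - 4h]
    does; an entry below [16 - 20h] raises it to less than [4 - 4h], so that the second
    neighbour remains stable. The corner [x = y] is reached from two sides only, and
    the origin at time 2 is the only active site at phase 2 that may be unstable. *)
Record even_profile t : Prop := EvenProfile {
  even_far : forall x y, (x <= y)%N -> (t + 3 <= 2 * y)%N -> c t x y = h;
  even_ahead : forall x y, (x <= y)%N -> (t + 2 = 2 * y)%N ->
    (x == y) || odd (x + y) -> c t x y = h;
  even_loaded : forall x y, (x < y)%N ->
    (t + 2 = 2 * y \/ t + 1 = 2 * y)%N -> ~~ odd (x + y) ->
    h + 1 / 4 <= c t x y < 1;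
  even_corner : forall y, (t + 1 = 2 * y)%N -> c t y y = h;
  even_first : forall x y, (x <= y)%N -> (t + 1 = 2 * y)%N -> odd (x + y) ->
    1 <= c t x y < 4 - 4 * h;
  even_second : forall x y, (x <= y)%N -> (t = 2 * y)%N -> ~~ odd (x + y) ->
    4 - 4 * h <= c t x y < 16 - 20 * h;
  even_second_corner : forall y, (0 < y)%N -> (t = 2 * y)%N -> c t y y < 2 - h;
  even_hole0 : forall x y, (x <= y)%N -> (t = 2 * y)%N -> odd (x + y) ->
    c t x y = 0;
  even_quiet1 : forall x y, (x <= y)%N -> (t = 2 * y + 1)%N -> odd (x + y) ->
    c t x y < 1;
  even_hole1 : forall x y, (x <= y)%N -> (t = 2 * y + 1)%N -> ~~ odd (x + y) ->
    c t x y = 0;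
  even_quiet2 : forall x y, (x <= y)%N -> (t = 2 * y + 2)%N -> ~~ odd (x + y) ->
    (0 < y)%N -> c t x y < 1;
  even_origin2 : t = 2%N -> c t 0%N 0%N < 4 - 4 * h;
  even_inner3 : forall x y, (x <= y)%N -> (t = 2 * y + 3)%N -> odd (x + y) ->
    c t x y <= 11 / 4;
  even_inner4 : forall x y, (x <= y)%N -> (t = 2 * y + 4)%N -> ~~ odd (x + y) ->
    c t x y <= 5 }.

Ltac range := move: h_lo h_hi n_lo n_hi; lra.

Let h1 : h < 1. Proof. range. Qed.
Let n7 : n <= 7. Proof. range. Qed.

Lemma even_profile0 : even_profile 0.
Proof.
have out x y : (0 < x + y)%N -> c 0 x y = h.
  by case: x y => [|x] [|y].
split; intros; try (exfalso; arith); try (by rewrite out; [|arith]).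
- have [-> ->] : x = 0%N /\ y = 0%N by arith.
  by rewrite /= n_lo n_hi.
Qed.

Section Step.
Variable t : nat.
Hypothesis P : even_profile t.

(** The front moves at most one line every two steps. *)
Lemma even_untouched x y : (x <= y)%N -> (t + 2 <= 2 * y)%N -> c t x y < 1.
Proof.
move=> xy ty; have [ty3|ty3] := leqP (t + 3) (2 * y).
  by rewrite (even_far P).
have [|/norP[xny ox]] := boolP ((x == y) || odd (x + y)).
  by move=> e; rewrite (even_ahead P xy ltac:(arith) e); range.
by have /andP[] := @even_loaded _ P x y ltac:(arith) ltac:(arith) ox.
Qed.

Ltac quiet := first
  [ solve [apply: even_untouched; arith]
  | solve [apply: (even_quiet1 P); arith]
  | solve [apply: (even_quiet2 P); arith]
  | solve [apply: quadrant_off_parity => //; arith]].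
Ltac silent u := let H := fresh in
  (have H : emitted u = 0 by apply: emitted_stable; quiet); rewrite H {H}.

Lemma even_far_step x y : (x <= y)%N -> (t.+1 + 3 <= 2 * y)%N -> c t.+1 x y = h.
Proof.
have bx := backP x.
rewrite leq_eqVlt => /orP[/eqP xy|xy] ty.
  rewrite xy quadrant_diagonal; last by arith.
  silent (c t y y.+1); silent (c t y.-1 y).
  by rewrite (even_far P (leqnn y) ltac:(arith)) kept_stable //; lra.
rewrite quadrant_inside //.
silent (c t x.+1 y); silent (c t (back x) y); silent (c t x y.+1); silent (c t x y.-1).
by rewrite (even_far P (ltnW xy) ltac:(arith)) kept_stable //; lra.
Qed.

Lemma even_ahead_step x y : (x <= y)%N -> (t.+1 + 2 = 2 * y)%N ->
  (x == y) || odd (x + y) -> c t.+1 x y = h.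
Proof.
rewrite leq_eqVlt => /orP[/eqP xy|xy] ty oxy.
  rewrite xy quadrant_diagonal; last by arith.
  silent (c t y y.+1); silent (c t y.-1 y).
  by rewrite (even_far P (leqnn y) ltac:(arith)) kept_stable //; lra.
rewrite quadrant_off_parity_step //; last by arith.
by rewrite (even_far P (ltnW xy) ltac:(arith)) kept_stable.
Qed.

Lemma even_loaded_step x y : (x < y)%N ->
  (t.+1 + 2 = 2 * y \/ t.+1 + 1 = 2 * y)%N -> ~~ odd (x + y) ->
  h + 1 / 4 <= c t.+1 x y < 1.
Proof.
have bx := backP x.
move=> xy [] ty oxy; last first.
  have /andP[lo hi] := @even_loaded _ P x y xy ltac:(arith) oxy.
  by rewrite quadrant_off_parity_step ?kept_stable ?lo //; arith.
rewrite quadrant_inside //.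
silent (c t x.+1 y); silent (c t (back x) y); silent (c t x y.+1).
have /andP[lo hi] := @even_first _ P x y.-1 ltac:(arith) ltac:(arith) ltac:(arith).
rewrite (even_far P (ltnW xy) ltac:(arith)) kept_stable // emitted_unstable //.
by apply/andP; split; lra.
Qed.

Lemma even_corner_step y : (t.+1 + 1 = 2 * y)%N -> c t.+1 y y = h.
Proof.
move=> ty; rewrite quadrant_off_parity_step //; last by arith.
by rewrite (@even_ahead _ P y y) ?eqxx ?kept_stable //; arith.
Qed.

Lemma even_first_step x y : (x <= y)%N -> (t.+1 + 1 = 2 * y)%N -> odd (x + y) ->
  1 <= c t.+1 x y < 4 - 4 * h.
Proof.
have bx := backP x.
move=> xy ty oxy; rewrite quadrant_inside; last by arith.
silent (c t x.+1 y); silent (c t (back x) y); silent (c t x y.+1).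
have /andP[lo hi] := @even_second _ P x y.-1 ltac:(arith) ltac:(arith) ltac:(arith).
have -> : c t x y = h by apply: (even_ahead P) => //; [arith | rewrite oxy orbT].
rewrite kept_stable // emitted_unstable; last by range.
by apply/andP; split; lra.
Qed.

Lemma even_second_step x y : (x <= y)%N -> (t.+1 = 2 * y)%N -> ~~ odd (x + y) ->
  4 - 4 * h <= c t.+1 x y < 16 - 20 * h /\ (x = y -> c t.+1 x y < 2 - h).
Proof.
have bx := backP x.
rewrite leq_eqVlt => /orP[/eqP ->|xy] ty oxy.
  rewrite quadrant_diagonal; last by arith.
  silent (c t y y.+1).
  have /andP[lo hi] := @even_first _ P y.-1 y ltac:(arith) ltac:(arith) ltac:(arith).
  rewrite (@even_corner _ P y ltac:(arith)) kept_stable // emitted_unstable //.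
  by split=> [|_]; [apply/andP; split; range | lra].
split; last by arith.
rewrite quadrant_inside //.
silent (c t x y.+1); silent (c t x y.-1).
have /andP[lo1 hi1] := @even_first _ P x.+1 y ltac:(arith) ltac:(arith) ltac:(arith).
have /andP[lo2 hi2] := @even_first _ P (back x) y ltac:(arith) ltac:(arith) ltac:(arith).
have /andP[lo hi] := @even_loaded _ P x y xy ltac:(arith) oxy.
rewrite kept_stable ?emitted_unstable //.
by apply/andP; split; range.
Qed.

Lemma even_hole0_step x y : (x <= y)%N -> (t.+1 = 2 * y)%N -> odd (x + y) ->
  c t.+1 x y = 0.
Proof.
move=> xy ty oxy; apply: quadrant_after_split => //.
by have /andP[] := @even_first _ P x y xy ltac:(arith) oxy.
Qed.

(** The two lateral neighbours send less than [16 - 20h <= 2] each, so the site stays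
    below 1 provided nothing comes from behind. Only next to the origin does something
    come from behind, and there the lateral neighbours are corners, which are
    smaller. *)
Lemma even_quiet1_step x y : (x <= y)%N -> (t.+1 = 2 * y + 1)%N -> odd (x + y) ->
  c t.+1 x y < 1.
Proof.
have bx := backP x.
move=> xy ty oxy; rewrite quadrant_inside; last by arith.
rewrite (even_hole0 P) //; last by arith.
silent (c t x y.+1); rewrite kept_stable ?ltr01 //.
have [y1|y1] := leqP y 1.
  have x0 : x = 0%N by arith.
  have {y1}y1 : y = 1%N by arith.
  have := @even_second_corner _ P 1 isT ltac:(arith).
  have := even_origin2 P ltac:(arith); rewrite x0 y1 /= => o e.
  have /andP[lo _] := @even_second _ P 1 1 isT ltac:(arith) isT.
  have := @emitted_le _ (c t 0 0) (4 - 4 * h) ltac:(range) (ltW o).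
  by rewrite (@emitted_unstable _ (c t 1 1)); range.
silent (c t x y.-1).
have /andP[lo1 hi1] := @even_second _ P x.+1 y ltac:(arith) ltac:(arith) ltac:(arith).
have /andP[lo2 hi2] := @even_second _ P (back x) y ltac:(arith) ltac:(arith) ltac:(arith).
by rewrite !emitted_unstable; range.
Qed.

Lemma even_hole1_step x y : (x <= y)%N -> (t.+1 = 2 * y + 1)%N -> ~~ odd (x + y) ->
  c t.+1 x y = 0.
Proof.
move=> xy ty oxy; apply: quadrant_after_split => //.
by have /andP[lo _] := @even_second _ P x y xy ltac:(arith) oxy; range.
Qed.

(** The site is empty and receives only from the front, less than [4 - 4h], and from
    the interior, at most [11/4]; as [4 - 4h <= 6/5] the sum is below 4. *)
Lemma even_quiet2_step x y : (x <= y)%N -> (t.+1 = 2 * y + 2)%N ->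
  ~~ odd (x + y) -> (0 < y)%N -> c t.+1 x y < 1.
Proof.
have bx := backP x.
move=> xy ty oxy y0.
have hole : c t x y = 0 by apply: (even_hole1 P); arith.
have /andP[lo hi] := @even_first _ P x y.+1 ltac:(arith) ltac:(arith) ltac:(arith).
move: xy hole lo hi; rewrite leq_eqVlt => /orP[/eqP ->|xy] hole lo hi.
  rewrite quadrant_diagonal // hole kept_stable ?ltr01 //.
  by silent (c t y.-1 y); rewrite emitted_unstable //; range.
rewrite quadrant_inside // hole kept_stable ?ltr01 //.
silent (c t x.+1 y); silent (c t (back x) y).
have r := @even_inner3 _ P x y.-1 ltac:(arith) ltac:(arith) ltac:(arith).
have := @emitted_le _ (c t x y.-1) (11 / 4) ltac:(lra) r.
by rewrite (emitted_unstable lo); range.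
Qed.

Lemma even_origin2_step : t.+1 = 2%N -> c t.+1 0%N 0%N < 4 - 4 * h.
Proof.
move=> t2; rewrite quadrant_origin (even_hole1 P) //; last by arith.
rewrite kept_stable ?ltr01 // add0r.
have /andP[lo hi] := @even_first _ P 0 1 isT ltac:(arith) isT.
by rewrite emitted_unstable.
Qed.

(** Starting from less than 1, the site receives less than 2 from the front and at most 5
    from the interior, its lateral neighbours being quiet: [1 + 7/4 = 11/4]. *)
Lemma even_inner3_step x y : (x <= y)%N -> (t.+1 = 2 * y + 3)%N -> odd (x + y) ->
  c t.+1 x y <= 11 / 4.
Proof.
have bx := backP x.
move=> xy ty oxy; rewrite quadrant_inside; last by arith.
silent (c t x.+1 y); silent (c t (back x) y).
have /andP[_ w] := @even_second _ P x y.+1 ltac:(arith) ltac:(arith) ltac:(arith).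
have s := @even_inner4 _ P x y.-1 ltac:(arith) ltac:(arith) ltac:(arith).
have := kept_lt1 (c t x y).
have := @emitted_le _ (c t x y.-1) 5 ltac:(lra) s.
have := @emitted_le _ (c t x y.+1) 2 ltac:(lra) ltac:(range).
by lra.
Qed.

(** This is where the uniform bound enters: [1 + (2 * 11/4 + 8) / 4 <= 5]. *)
Lemma even_inner4_step x y : (x <= y)%N -> (t.+1 = 2 * y + 4)%N ->
  ~~ odd (x + y) -> c t.+1 x y <= 5.
Proof.
have bx := backP x.
have := kept_lt1 (c t x y).
rewrite leq_eqVlt => k /orP[/eqP e|xy] ty oxy.
  move: k; rewrite e; case: y e ty oxy => [|y] e ty oxy k.
    by rewrite quadrant_origin; silent (c t 0 1); lra.
  rewrite quadrant_diagonal //; silent (c t y.+1 y.+2).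
  have r := @even_inner3 _ P y y.+1 ltac:(arith) ltac:(arith) ltac:(arith).
  by have /= := @emitted_le _ (c t y y.+1) (11 / 4) ltac:(lra) r; lra.
rewrite quadrant_inside //; silent (c t x y.+1).
have r1 := @even_inner3 _ P x.+1 y ltac:(arith) ltac:(arith) ltac:(arith).
have r2 := @even_inner3 _ P (back x) y ltac:(arith) ltac:(arith) ltac:(arith).
have := @emitted_le _ (c t x.+1 y) (11 / 4) ltac:(lra) r1.
have := @emitted_le _ (c t (back x) y) (11 / 4) ltac:(lra) r2.
have := @emitted_le _ (c t x y.-1) 8 ltac:(lra) (quadrant_le8 h1 t x y.-1 n7).
by lra.
Qed.

Lemma even_profile_step : even_profile t.+1.
Proof.
split.
- exact: even_far_step.
- exact: even_ahead_step.
- exact: even_loaded_step.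
- exact: even_corner_step.
- exact: even_first_step.
- by move=> x y xy ty oxy; case: (even_second_step xy ty oxy).
- move=> y y0 ty; have [|_ ->] // := @even_second_step y y (leqnn y) ty.
  by rewrite addnn odd_double.
- exact: even_hole0_step.
- exact: even_quiet1_step.
- exact: even_hole1_step.
- exact: even_quiet2_step.
- exact: even_origin2_step.
- exact: even_inner3_step.
- exact: even_inner4_step.
Qed.

End Step.

Lemma even_profileT t : even_profile t.
Proof. by elim: t => [|t /even_profile_step //]; exact: even_profile0. Qed.

End SquareEvenPhase.

(** * The square when [n = 16 - 20h] *)

Section SquareOddPhase.
Variables (R : realType) (n h : R).
Hypotheses (h_lo : 7 / 10 <= h) (h_hi : h < 40 / 57) (nE : n = 16 - 20 * h).
Implicit Types t x y : nat.
Local Notation c := (quadrant n h).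

(** As for [even_profile], with phase [t + 1 - 2y]: the line is invaded at phases -1
    ([odd_first]) and 0 ([odd_second]), while the corner [x = y] is reached only at phase
    1 ([odd_third_corner]). The sites next to the corner are not loaded beforehand, and
    the corner behind them is unstable when they are invaded; the bounds [29/28], [4/3]
    and [11/8] for [odd_first_edge], [odd_second_edge] and [odd_third_corner] reproduce
    one another. The profile starts at time 1. *)
Record odd_profile t : Prop := OddProfile {
  odd_far : forall x y, (x <= y)%N -> (t + 4 <= 2 * y)%N -> c t x y = h;
  odd_ahead : forall x y, (x <= y)%N -> (t + 3 = 2 * y)%N ->
    (y <= x.+1)%N || ~~ odd (x + y) -> c t x y = h;
  odd_ahead_edge : forall x y, (x <= y <= x.+1)%N -> (t + 2 = 2 * y)%N ->
    c t x y = h;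
  odd_corner : forall y, (t + 1 = 2 * y)%N -> c t y y = h;
  odd_loaded : forall x y, (x.+1 < y)%N ->
    (t + 3 = 2 * y \/ t + 2 = 2 * y)%N -> odd (x + y) ->
    h + 1 / 4 <= c t x y < 1;
  odd_first : forall x y, (x < y)%N -> (t + 2 = 2 * y)%N -> ~~ odd (x + y) ->
    1 <= c t x y < 4 - 4 * h;
  odd_first_edge : forall x, (t + 2 = 2 * x.+2)%N -> c t x x.+2 <= 29 / 28;
  odd_second : forall x y, (x <= y)%N -> (t + 1 = 2 * y)%N -> odd (x + y) ->
    4 - 4 * h <= c t x y < 16 - 20 * h;
  odd_second_edge : forall x, (t + 1 = 2 * x.+1)%N -> c t x x.+1 <= 4 / 3;
  odd_hole0 : forall x y, (x < y)%N -> (t + 1 = 2 * y)%N -> ~~ odd (x + y) ->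
    c t x y = 0;
  odd_third_corner : forall y, (0 < y)%N -> (t = 2 * y)%N ->
    5 / 4 <= c t y y <= 11 / 8;
  odd_quiet1 : forall x y, (x < y)%N -> (t = 2 * y)%N -> ~~ odd (x + y) ->
    c t x y < 1;
  odd_hole1 : forall x y, (x <= y)%N -> (t = 2 * y)%N -> odd (x + y) ->
    c t x y = 0;
  odd_quiet2 : forall x y, (x <= y)%N -> (t = 2 * y + 1)%N -> odd (x + y) ->
    (1 < y)%N -> c t x y < 1;
  odd_axis2 : t = 3%N -> c t 0%N 1%N <= 9 / 7;
  odd_hole2 : forall y, (t = 2 * y + 1)%N -> c t y y = 0;
  odd_inner3 : forall x y, (x <= y)%N -> (t = 2 * y + 2)%N -> ~~ odd (x + y) ->
    c t x y <= 11 / 4;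
  odd_inner3_corner : forall y, (t = 2 * y + 2)%N -> c t y y <= 4 / 3;
  odd_inner4 : forall x y, (x <= y)%N -> (t = 2 * y + 3)%N -> odd (x + y) ->
    c t x y <= 5 }.

Ltac range := move: h_lo h_hi nE; lra.

Let h1 : h < 1. Proof. range. Qed.
Let n7 : n <= 7. Proof. range. Qed.

Lemma odd_profile1 : odd_profile 1.
Proof.
have c0 x y : (0 < x + y)%N -> c 0 x y = h by case: x y => [|x] [|y].
have c00 : c 0 0 0 = n by [].
have c1 x y : (x <= y)%N -> (1 < y)%N -> c 1 x y = h.
  case: y => [|[|y]] //= _ _.
  by rewrite !andbF !(emitted_stable h1) kept_stable //; lra.
have c100 : c 1 0 0 = 0.
  by rewrite quadrant_origin c00 kept_unstable ?c0 ?emitted_stable //; range.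
have c101 : c 1 0 1 = 4 - 4 * h.
  rewrite quadrant_inside //= (emitted_stable h1).
  by rewrite kept_stable // emitted_unstable; range.
have c111 : c 1 1 1 = h.
  by rewrite quadrant_diagonal // !c0 // (emitted_stable h1) kept_stable //; lra.
split; intros; try (exfalso; arith); try (by apply: c1; arith).
- by have -> : y = 1%N by arith.
- have [-> ->] : x = 0%N /\ y = 1%N by arith.
  by rewrite c101; apply/andP; split; range.
- have -> : x = 0%N by arith.
  by rewrite c101; range.
- by have -> : y = 0%N by arith.
Qed.

Section Step.
Variable t : nat.
Hypothesis P : odd_profile t.

Lemma odd_untouched x y : (x <= y)%N -> (t + 3 <= 2 * y)%N -> c t x y < 1.
Proof.
move=> xy ty; have [ty3|ty3] := leqP (t + 4) (2 * y).
  by rewrite (odd_far P).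
have [e|/norP[xny ox]] := boolP ((y <= x.+1)%N || ~~ odd (x + y)).
  by rewrite (odd_ahead P xy ltac:(arith) e).
by have /andP[] := @odd_loaded _ P x y ltac:(arith) ltac:(arith) ltac:(arith).
Qed.

Ltac quiet := first
  [ solve [apply: odd_untouched; arith]
  | solve [apply: (odd_quiet1 P); arith]
  | solve [apply: (odd_quiet2 P); arith]
  | solve [apply: quadrant_off_parity => //; arith]].
Ltac silent u := let H := fresh in
  (have H : emitted u = 0 by apply: emitted_stable; quiet); rewrite H {H}.

Lemma odd_far_step x y : (x <= y)%N -> (t.+1 + 4 <= 2 * y)%N -> c t.+1 x y = h.
Proof.
have bx := backP x.
rewrite leq_eqVlt => /orP[/eqP xy|xy] ty.
  rewrite xy quadrant_diagonal; last by arith.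
  silent (c t y y.+1); silent (c t y.-1 y).
  by rewrite (odd_far P (leqnn y) ltac:(arith)) kept_stable //; lra.
rewrite quadrant_inside //.
silent (c t x.+1 y); silent (c t (back x) y); silent (c t x y.+1); silent (c t x y.-1).
by rewrite (odd_far P (ltnW xy) ltac:(arith)) kept_stable //; lra.
Qed.

Lemma odd_ahead_step x y : (x <= y)%N -> (t.+1 + 3 = 2 * y)%N ->
  (y <= x.+1)%N || ~~ odd (x + y) -> c t.+1 x y = h.
Proof.
have bx := backP x.
move=> xy ty exy; have far := odd_far P xy ltac:(arith).
have [oxy|oxy] := boolP (odd (x + y)); last first.
  by rewrite quadrant_off_parity_step // ?far ?kept_stable //; arith.
have yx : y = x.+1 by arith.
rewrite quadrant_inside; last by arith.
have edge := @odd_ahead_edge _ P x y.-1 ltac:(arith) ltac:(arith).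
silent (c t x.+1 y); silent (c t (back x) y); silent (c t x y.+1).
by rewrite edge far (emitted_stable h1) kept_stable //; lra.
Qed.

Lemma odd_ahead_edge_step x y : (x <= y <= x.+1)%N -> (t.+1 + 2 = 2 * y)%N ->
  c t.+1 x y = h.
Proof.
move=> xy ty.
have ahead := @odd_ahead _ P x y ltac:(arith) ltac:(arith) ltac:(arith).
have [oxy|oxy] := boolP (odd (x + y)).
  by rewrite quadrant_off_parity_step // ?ahead ?kept_stable //; arith.
move: ahead; have -> : x = y by arith.
rewrite quadrant_diagonal => [ahead|]; last by arith.
silent (c t y y.+1); silent (c t y.-1 y).
by rewrite ahead kept_stable //; lra.
Qed.

Lemma odd_corner_step y : (t.+1 + 1 = 2 * y)%N -> c t.+1 y y = h.
Proof.
move=> ty; rewrite quadrant_off_parity_step //; last by arith.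
by rewrite (@odd_ahead_edge _ P y y) ?kept_stable //; arith.
Qed.

Lemma odd_loaded_step x y : (x.+1 < y)%N ->
  (t.+1 + 3 = 2 * y \/ t.+1 + 2 = 2 * y)%N -> odd (x + y) ->
  h + 1 / 4 <= c t.+1 x y < 1.
Proof.
have bx := backP x.
move=> xy [] ty oxy; last first.
  have /andP[lo hi] := @odd_loaded _ P x y xy ltac:(arith) oxy.
  by rewrite quadrant_off_parity_step ?kept_stable ?lo //; arith.
rewrite quadrant_inside; last by arith.
silent (c t x.+1 y); silent (c t (back x) y); silent (c t x y.+1).
have /andP[lo hi] := @odd_first _ P x y.-1 ltac:(arith) ltac:(arith) ltac:(arith).
have far := @odd_far _ P x y ltac:(arith) ltac:(arith).
rewrite far kept_stable // emitted_unstable //.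
by apply/andP; split; lra.
Qed.

Lemma odd_first_step x y : (x < y)%N -> (t.+1 + 2 = 2 * y)%N -> ~~ odd (x + y) ->
  1 <= c t.+1 x y < 4 - 4 * h /\ (y = x.+2 -> c t.+1 x y <= 29 / 28).
Proof.
have bx := backP x.
move=> xy ty oxy; rewrite quadrant_inside //.
have /andP[lo hi] := @odd_second _ P x y.-1 ltac:(arith) ltac:(arith) ltac:(arith).
have ahead := odd_ahead P (ltnW xy) ltac:(arith) ltac:(arith).
have edge : y = x.+2 -> c t x y.-1 <= 4 / 3.
  by move=> yx; rewrite yx; apply: (odd_second_edge P); arith.
silent (c t x.+1 y); silent (c t (back x) y); silent (c t x y.+1).
rewrite ahead kept_stable // emitted_unstable; last by range.
by split=> [|/edge]; [apply/andP; split; lra | range].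
Qed.

Lemma odd_second_step x y : (x <= y)%N -> (t.+1 + 1 = 2 * y)%N -> odd (x + y) ->
  (1 < y)%N ->
  4 - 4 * h <= c t.+1 x y < 16 - 20 * h /\ (y = x.+1 -> c t.+1 x y <= 4 / 3).
Proof.
have bx := backP x.
move=> xy ty oxy y1; rewrite quadrant_inside; last by arith.
silent (c t x y.+1).
have [yx|yx] := leqP y x.+1.
  have yE : y = x.+1 by arith.
  have x0 : (0 < x)%N by arith.
  have ahead := @odd_ahead_edge _ P x y ltac:(arith) ltac:(arith).
  have aheadc := @odd_ahead_edge _ P x.+1 y ltac:(arith) ltac:(arith).
  rewrite ahead aheadc (emitted_stable h1) kept_stable //.
  have /andP[lo1 hi1] := @odd_first _ P (back x) y ltac:(arith) ltac:(arith) ltac:(arith).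
  have := @odd_first_edge _ P (back x) ltac:(arith).
  have -> : (back x).+2 = y by arith.
  have := @odd_third_corner _ P x x0 ltac:(arith) => /andP[lo2 hi2] edge.
  have -> : y.-1 = x by arith.
  rewrite !emitted_unstable //; last by lra.
  by split=> [|_]; [apply/andP; split; range | range].
split; last by arith.
silent (c t x y.-1).
have /andP[lo1 hi1] := @odd_first _ P x.+1 y ltac:(arith) ltac:(arith) ltac:(arith).
have /andP[lo2 hi2] := @odd_first _ P (back x) y ltac:(arith) ltac:(arith) ltac:(arith).
have /andP[lo hi] := @odd_loaded _ P x y yx ltac:(arith) oxy.
rewrite kept_stable ?emitted_unstable //.
by apply/andP; split; range.
Qed.

Lemma odd_hole0_step x y : (x < y)%N -> (t.+1 + 1 = 2 * y)%N -> ~~ odd (x + y) ->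
  c t.+1 x y = 0.
Proof.
move=> xy ty oxy; apply: quadrant_after_split => //.
by have /andP[] := @odd_first _ P x y xy ltac:(arith) oxy.
Qed.

Lemma odd_third_corner_step y : (0 < y)%N -> (t.+1 = 2 * y)%N ->
  5 / 4 <= c t.+1 y y <= 11 / 8.
Proof.
move=> y0 ty; rewrite quadrant_diagonal //.
silent (c t y y.+1).
have /andP[lo hi] := @odd_second _ P y.-1 y ltac:(arith) ltac:(arith) ltac:(arith).
have := @odd_second_edge _ P y.-1 ltac:(arith); rewrite prednK // => edge.
rewrite (odd_corner P) ?kept_stable ?emitted_unstable //; [|range|arith].
by apply/andP; split; range.
Qed.

(** For [y > 2] the site behind is quiet and the two lateral neighbours send less than 2
    each. For [y = 2] the site [(0, 1)] behind is unstable, but the lateral neighbours are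
    next to the corner: [(2 * 4/3 + 9/7) / 4 < 1]. *)
Lemma odd_quiet1_step x y : (x < y)%N -> (t.+1 = 2 * y)%N -> ~~ odd (x + y) ->
  c t.+1 x y < 1.
Proof.
have bx := backP x.
move=> xy ty oxy; rewrite quadrant_inside //.
rewrite (odd_hole0 P) //; last by arith.
silent (c t x y.+1); rewrite kept_stable ?ltr01 //.
have /andP[lo1 hi1] := @odd_second _ P x.+1 y ltac:(arith) ltac:(arith) ltac:(arith).
have /andP[lo2 hi2] := @odd_second _ P (back x) y ltac:(arith) ltac:(arith) ltac:(arith).
have [y2|y2] := leqP y 2; last first.
  by silent (c t x y.-1); rewrite !emitted_unstable; range.
have {y2}y2 : y = 2%N by arith.
have x0 : x = 0%N by arith.
have edge := @odd_second_edge _ P 1 ltac:(arith).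
have axis := odd_axis2 P ltac:(arith).
have := @emitted_le _ (c t 0 1) (9 / 7) ltac:(lra) axis.
move: lo1 lo2; rewrite x0 y2 /= => lo1 lo2.
by rewrite (@emitted_unstable _ (c t 1 2)); range.
Qed.

Lemma odd_hole1_step x y : (x <= y)%N -> (t.+1 = 2 * y)%N -> odd (x + y) ->
  c t.+1 x y = 0.
Proof.
move=> xy ty oxy; apply: quadrant_after_split => //.
by have /andP[lo _] := @odd_second _ P x y xy ltac:(arith) oxy; range.
Qed.

(** Away from the corner the estimate is that of the other phase. Next to it, the
    contributions of the corner, of the front and of the diagonal behind are
    [11/8], [29/28] and [4/3], whose sum is below 4. *)
Lemma odd_quiet2_step x y : (x <= y)%N -> (t.+1 = 2 * y + 1)%N ->
  odd (x + y) -> (1 < y)%N -> c t.+1 x y < 1.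
Proof.
have bx := backP x.
move=> xy ty oxy y1; rewrite quadrant_inside; last by arith.
rewrite (odd_hole1 P) //; last by arith.
rewrite kept_stable ?ltr01 //.
have /andP[lo hi] := @odd_first _ P x y.+1 ltac:(arith) ltac:(arith) ltac:(arith).
rewrite (emitted_unstable lo).
silent (c t (back x) y).
have [yx|yx] := leqP y x.+1.
  have yE : y = x.+1 by arith.
  have := @odd_first_edge _ P x ltac:(arith).
  have /andP[_ hic] := @odd_third_corner _ P y ltac:(arith) ltac:(arith).
  have hir := @odd_inner3_corner _ P x ltac:(arith).
  have := @emitted_le _ _ (11 / 8) ltac:(lra) hic.
  have := @emitted_le _ _ (4 / 3) ltac:(lra) hir.
  have -> : y.-1 = x by arith.
  by rewrite -yE; lra.
silent (c t x.+1 y).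
have r := @odd_inner3 _ P x y.-1 ltac:(arith) ltac:(arith) ltac:(arith).
have := @emitted_le _ (c t x y.-1) (11 / 4) ltac:(lra) r.
by range.
Qed.

Lemma odd_axis2_step : t.+1 = 3%N -> c t.+1 0%N 1%N <= 9 / 7.
Proof.
move=> t3; rewrite quadrant_inside // (@odd_hole1 _ P 0 1) //; last by arith.
rewrite kept_stable ?ltr01 //=.
have /andP[_ hic] := @odd_third_corner _ P 1 isT ltac:(arith).
have hir := @odd_inner3_corner _ P 0 ltac:(arith).
have hiv := @odd_first_edge _ P 0 ltac:(arith).
have := @emitted_le _ _ (11 / 8) ltac:(lra) hic.
have := @emitted_le _ _ (4 / 3) ltac:(lra) hir.
have := @emitted_le _ _ (29 / 28) ltac:(lra) hiv.
by lra.
Qed.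

Lemma odd_hole2_step y : (0 < t)%N -> (t.+1 = 2 * y + 1)%N -> c t.+1 y y = 0.
Proof.
move=> t0 ty; apply: quadrant_after_split => //.
by have /andP[lo _] := @odd_third_corner _ P y ltac:(arith) ltac:(arith); lra.
Qed.

Lemma odd_inner3_corner_step y : (t.+1 = 2 * y + 2)%N -> c t.+1 y y <= 4 / 3.
Proof.
move=> ty; have hole := @odd_hole2 _ P y ltac:(arith).
have edge := @odd_second_edge _ P y ltac:(arith).
have := @emitted_le _ _ (4 / 3) ltac:(lra) edge.
case: y ty hole {edge} => [|[|y]] ty hole.
- by rewrite quadrant_origin hole kept_stable ?ltr01 // add0r.
- rewrite quadrant_diagonal // hole kept_stable ?ltr01 //=.
  have := @emitted_le _ _ (9 / 7) ltac:(lra) (odd_axis2 P ltac:(arith)).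
  by lra.
- rewrite quadrant_diagonal // hole kept_stable ?ltr01 //=.
  by silent (c t y.+1 y.+2); lra.
Qed.

Lemma odd_inner3_step x y : (x <= y)%N -> (t.+1 = 2 * y + 2)%N -> ~~ odd (x + y) ->
  c t.+1 x y <= 11 / 4.
Proof.
have bx := backP x.
rewrite leq_eqVlt => /orP[/eqP e|xy] ty oxy.
  by rewrite e (le_trans (odd_inner3_corner_step ty)) //; lra.
rewrite quadrant_inside //.
silent (c t x.+1 y); silent (c t (back x) y).
have /andP[_ w] := @odd_second _ P x y.+1 ltac:(arith) ltac:(arith) ltac:(arith).
have s := @odd_inner4 _ P x y.-1 ltac:(arith) ltac:(arith) ltac:(arith).
have := kept_lt1 (c t x y).
have := @emitted_le _ (c t x y.-1) 5 ltac:(lra) s.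
have := @emitted_le _ (c t x y.+1) 2 ltac:(lra) ltac:(range).
by lra.
Qed.

Lemma odd_inner4_step x y : (x <= y)%N -> (t.+1 = 2 * y + 3)%N -> odd (x + y) ->
  c t.+1 x y <= 5.
Proof.
have bx := backP x.
move=> xy ty oxy; have := kept_lt1 (c t x y).
rewrite quadrant_inside; last by arith.
silent (c t x y.+1).
have r1 := @odd_inner3 _ P x.+1 y ltac:(arith) ltac:(arith) ltac:(arith).
have r2 := @odd_inner3 _ P (back x) y ltac:(arith) ltac:(arith) ltac:(arith).
have := @emitted_le _ (c t x.+1 y) (11 / 4) ltac:(lra) r1.
have := @emitted_le _ (c t (back x) y) (11 / 4) ltac:(lra) r2.
have := @emitted_le _ (c t x y.-1) 8 ltac:(lra) (quadrant_le8 h1 t x y.-1 n7).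
by lra.
Qed.

Lemma odd_profile_step : (0 < t)%N -> odd_profile t.+1.
Proof.
move=> t0; split.
- exact: odd_far_step.
- exact: odd_ahead_step.
- exact: odd_ahead_edge_step.
- exact: odd_corner_step.
- exact: odd_loaded_step.
- by move=> x y xy ty oxy; case: (odd_first_step xy ty oxy).
- by move=> x ty; case: (@odd_first_step x x.+2 ltac:(arith) ty ltac:(arith)) => _ ->.
- by move=> x y xy ty oxy; case: (odd_second_step xy ty oxy ltac:(arith)).
- move=> x ty.
  by case: (@odd_second_step x x.+1 ltac:(arith) ty ltac:(arith) ltac:(arith)) => _ ->.
- exact: odd_hole0_step.
- exact: odd_third_corner_step.
- exact: odd_quiet1_step.
- exact: odd_hole1_step.
- exact: odd_quiet2_step.
- exact: odd_axis2_step.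
- by move=> y; exact: odd_hole2_step.
- exact: odd_inner3_step.
- exact: odd_inner3_corner_step.
- exact: odd_inner4_step.
Qed.

End Step.

Lemma odd_profileT t : odd_profile t.+1.
Proof.
by elim: t => [|t IH]; [exact: odd_profile1 | exact: odd_profile_step].
Qed.

End SquareOddPhase.

(** * The octagon as a travelling wave *)

Section OctagonWave.
Variables (R : realType) (h : R).
Hypotheses (h_lo : 5 / 7 <= h) (h_hi : h < 13 / 18).
Implicit Types t x y : nat.
Local Notation c := (quadrant 3 h).

(** One field for each phase [3t - 5y - x]: [wave_m4] and [wave_m2] are phases -4 and
    -2, [wave_far] and [wave_loaded] are the stable phases, and [wave_hole] gathers the
    odd phases from -1 on. A site of phase [p] comes from phase [p - 3] and receives
    from phases [p - 4], [p - 2], [p - 8] and [p + 2]; on the axis the phase [p - 2] is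
    replaced by a second [p - 4], and on the diagonal [p - 4] and [p + 2] are replaced by
    [p - 8] and [p - 2]. The lower bounds, multiples of [1/56], satisfy the inequalities
    that this recurrence yields for the worst case [h = 5/7], with separate values on and
    off the axis. Upper bounds matter only near the front, which must not run ahead: below
    [4 - 4h] a site leaves its outer neighbour stable, below [16 - 20h] it leaves the
    second one stable, and [20/9] at phase 0 keeps phase -2 below [16 - 20h] exactly when
    [h < 13/18]. *)
Record wave t : Prop := Wave {
  wave_far : forall x y, (x <= y)%N ->
    (3 * t + 5 = 5 * y + x \/ 3 * t + 7 <= 5 * y + x)%N -> c t x y = h;
  wave_corner : forall y, (t + 2 = 2 * y \/ t + 1 = 2 * y)%N -> c t y y = h;
  wave_loaded : forall x y, (x < y)%N ->
    (3 * t + 6 = 5 * y + x \/ 3 * t + 3 = 5 * y + x)%N ->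
    27 / 28 <= c t x y /\ c t x y < 1;
  wave_m4 : forall x y, (x <= y)%N -> (3 * t + 4 = 5 * y + x)%N ->
    [/\ 1 <= c t x y, c t x y < 4 - 4 * h
      & (0 < x)%N -> 29 / 28 <= c t x y];
  wave_m2 : forall x y, (x <= y)%N -> (3 * t + 2 = 5 * y + x)%N ->
    [/\ 8 / 7 <= c t x y, c t x y < 16 - 20 * h
      & (0 < x)%N -> 73 / 56 <= c t x y];
  wave_0 : forall x y, (x <= y)%N -> (0 < y)%N -> (3 * t = 5 * y + x)%N ->
    [/\ 19 / 14 <= c t x y, c t x y <= 20 / 9,
        (x < y)%N -> 97 / 56 <= c t x y
      & (0 < x < y)%N -> 99 / 56 <= c t x y];
  wave_2 : forall x y, (x <= y)%N -> (3 * t = 5 * y + x + 2)%N ->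
    [/\ 1 <= c t x y, c t x y <= 2
      & (0 < x)%N -> 29 / 28 <= c t x y];
  wave_4 : forall x y, (x <= y)%N -> (3 * t = 5 * y + x + 4)%N ->
    31 / 28 <= c t x y /\
    (x = 0%N -> (1 < y)%N -> 39 / 28 <= c t x y);
  wave_6 : forall x y, (x <= y)%N -> (3 * t = 5 * y + x + 6)%N ->
    59 / 56 <= c t x y;
  wave_8 : forall x y, (x <= y)%N -> (5 * y + x + 8 <= 3 * t)%N ->
    ~~ odd (t + x + y) -> 1 <= c t x y;
  wave_hole : forall x y, (x <= y)%N -> (5 * y + x <= 3 * t + 1)%N ->
    odd (t + x + y) -> c t x y = 0;
  wave_le3 : forall x y, (x <= y)%N -> (5 * y + x + 4 <= 3 * t)%N ->
    c t x y <= 3 }.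

Ltac range := move: h_lo h_hi; lra.

Let h1 : h < 1. Proof. range. Qed.

Lemma start_origin : c 0 0 0 = 3. Proof. by []. Qed.

Lemma start_outside x y : (0 < x + y)%N -> c 0 x y = h.
Proof. by case: x y => [|x] [|y]. Qed.

Lemma step1_outside x y : (1 < x + y)%N -> c 1 x y = h.
Proof.
by case: x y => [|[|x]] [|[|y]] //= _;
  rewrite ?andbF /= !(emitted_stable h1) kept_stable //; lra.
Qed.

Local Arguments quadrant : simpl never.

Lemma wave_start0 : wave 0.
Proof.
by split; intros; try (exfalso; arith); apply: start_outside; arith.
Qed.

(** The first four steps, run explicitly: the cells next to the origin are
    reached under more favourable conditions than the travelling wave gives. *)
Lemma wave_start :
  [/\ 10 / 7 <= c 2 1 1, 19 / 14 <= c 3 0 1 & 1 <= c 4 0 2].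
Proof.
have out := step1_outside; have out0 := start_outside.
have c101 : c 1 0 1 = h + 3 / 4.
  rewrite quadrant_inside //= start_origin !out0 // (emitted_stable h1) kept_stable //.
  by rewrite emitted_unstable; lra.
have c100 : c 1 0 0 = 0.
  by rewrite quadrant_origin start_origin out0 // kept_unstable ?emitted_stable ?addr0 //; lra.
have e101 : emitted (c 1 0 1) = h + 3 / 4 by rewrite emitted_unstable c101 //; range.
have eh : emitted h = 0 by exact: emitted_stable.
have c211 : c 2 1 1 = h + (h + 3 / 4) / 2.
  by rewrite quadrant_diagonal //= (out 1%N 1%N) // (out 1%N 2%N) // e101 eh kept_stable //; lra.
have c202 : c 2 0 2 = h + (h + 3 / 4) / 4.
  rewrite quadrant_inside //= (out 0%N 2%N) // (out 1%N 2%N) // (out 0%N 3%N) //.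
  by rewrite e101 eh kept_stable //; lra.
have c200 : c 2 0 0 = h + 3 / 4.
  by rewrite quadrant_origin c100 kept_stable ?ltr01 // e101; lra.
have c201 : c 2 0 1 = 0 by apply: quadrant_after_split => //; rewrite c101; range.
have e211 : emitted (c 2 1 1) = c 2 1 1 by rewrite emitted_unstable // c211; range.
have e202 : emitted (c 2 0 2) = c 2 0 2 by rewrite emitted_unstable // c202; range.
have e200 : emitted (c 2 0 0) = c 2 0 0 by rewrite emitted_unstable // c200; range.
have c301 : c 3 0 1 = (2 * c 2 1 1 + c 2 0 2 + c 2 0 0) / 4.
  rewrite quadrant_inside //= c201 kept_stable ?ltr01 // e211 e202 e200; lra.
have c212 : c 2 1 2 = h.
  by rewrite quadrant_off_parity_step // out // kept_stable.
have c312 : h + (c 2 0 2 + c 2 1 1) / 4 <= c 3 1 2.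
  rewrite (@quadrant_inside R 3 h 2 1 2) //= c212 kept_stable // e211 e202.
  by have := emitted_ge0 (c 2 2 2); have := emitted_ge0 (c 2 1 3); lra.
have c302 : c 3 0 2 = 0 by apply: quadrant_after_split => //; rewrite c202; range.
have c402 : (2 * c 3 1 2 + c 3 0 1) / 4 <= c 4 0 2.
  rewrite (@quadrant_inside R 3 h 3 0 2) //= c302 kept_stable ?ltr01 //.
  rewrite !(@emitted_unstable _ (c 3 1 2)) ?(@emitted_unstable _ (c 3 0 1)).
  - by have := emitted_ge0 (c 3 0 3); lra.
  - by rewrite c301 c211 c202 c200; range.
  - by move: c312; rewrite c211 c202; range.
move: c402 c312; rewrite c301 c211 c202 c200 => c402 c312.
by split; range.
Qed.

Section Step.
Variable t : nat.
Hypothesis P : wave t.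

Lemma wave_untouched x y : (x <= y)%N -> (3 * t + 5 <= 5 * y + x)%N ->
  c t x y < 1.
Proof.
move=> xy t5; have [ty|ty] := eqVneq (5 * y + x)%N (3 * t + 6)%N.
  have [yx|yx] := eqVneq x y.
    by rewrite yx (@wave_corner _ P y) //; arith.
  by have [] := @wave_loaded _ P x y ltac:(arith) ltac:(arith).
by rewrite (wave_far P xy ltac:(arith)).
Qed.

(** All even phases from -4 on split, so that behind the front every active site is fed by
    four unstable neighbours and remains unstable. *)
Lemma wave_unstable x y : (x <= y)%N -> (5 * y + x <= 3 * t + 4)%N ->
  ~~ odd (t + x + y) -> 1 <= c t x y.
Proof.
move=> xy ty oxy.
have [e|n8] := leqP (5 * y + x + 8) (3 * t); first exact: wave_8.
have [e|n6] := eqVneq (3 * t)%N (5 * y + x + 6)%N.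
  by have := wave_6 P xy e; lra.
have [e|n4] := eqVneq (3 * t)%N (5 * y + x + 4)%N.
  by have [] := wave_4 P xy e; lra.
have [e|n2] := eqVneq (3 * t)%N (5 * y + x + 2)%N.
  by have [] := wave_2 P xy e; lra.
have [e|n0] := eqVneq (3 * t)%N (5 * y + x)%N.
  have [y0|y0] := posnP y; last by have [] := wave_0 P xy y0 e; lra.
  have [-> ->] : x = 0%N /\ t = 0%N by arith.
  by rewrite y0 start_origin; lra.
have [e|m2] := eqVneq (3 * t + 2)%N (5 * y + x)%N.
  by have [] := wave_m2 P xy e; lra.
by have [] := @wave_m4 _ P x y xy ltac:(arith); lra.
Qed.

(** Near the front the bounds by phase apply; behind it nothing is kept, and a value is an
    average of values at the previous time. *)
Lemma wave_all_le3 x y : (x <= y)%N -> c t x y <= 3.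
Proof.
move=> xy.
have [e|n4] := leqP (5 * y + x + 4) (3 * t); first exact: wave_le3.
have [oxy|oxy] := boolP (odd (t + x + y)).
  by have := @quadrant_off_parity _ 3 _ h1 _ _ _ oxy; lra.
have [e|n0] := leqP (3 * t + 5) (5 * y + x).
  by have := wave_untouched xy e; lra.
have [e|n2] := eqVneq (3 * t)%N (5 * y + x + 2)%N.
  by have [] := wave_2 P xy e; lra.
have [e|n00] := eqVneq (3 * t)%N (5 * y + x)%N.
  have [y0|y0] := posnP y; last by have [] := wave_0 P xy y0 e; lra.
  have [-> ->] : x = 0%N /\ t = 0%N by arith.
  by rewrite y0 start_origin; lra.
have [e|m2] := eqVneq (3 * t + 2)%N (5 * y + x)%N.
  by have [] := wave_m2 P xy e; range.
by have [] := @wave_m4 _ P x y xy ltac:(arith); range.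
Qed.

Ltac quiet := first
  [ solve [apply: wave_untouched; arith]
  | solve [apply: quadrant_off_parity => //; arith]].
Ltac silent u := let H := fresh in
  (have H : emitted u = 0 by apply: emitted_stable; quiet); rewrite H {H}.

Lemma wave_far_step x y : (x <= y)%N ->
  (3 * t.+1 + 5 = 5 * y + x \/ 3 * t.+1 + 7 <= 5 * y + x)%N -> c t.+1 x y = h.
Proof.
have bx := backP x.
move=> xy ty; have far := wave_far P xy ltac:(arith).
have [oxy|oxy] := boolP (odd (t.+1 + x + y)).
  by rewrite quadrant_off_parity_step // far kept_stable.
move: xy far; rewrite leq_eqVlt => /orP[/eqP yx|xy] far.
  rewrite yx quadrant_diagonal; last by arith.
  silent (c t y y.+1); silent (c t y.-1 y).
  by move: far; rewrite yx => ->; rewrite kept_stable //; lra.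
rewrite quadrant_inside //.
silent (c t x.+1 y); silent (c t (back x) y); silent (c t x y.+1); silent (c t x y.-1).
by rewrite far kept_stable //; lra.
Qed.

Lemma wave_corner_step y : (t.+1 + 2 = 2 * y \/ t.+1 + 1 = 2 * y)%N ->
  c t.+1 y y = h.
Proof.
case=> ty; last first.
  rewrite quadrant_off_parity_step //; last by arith.
  by rewrite (@wave_corner _ P y) ?kept_stable //; arith.
rewrite quadrant_diagonal; last by arith.
silent (c t y y.+1); silent (c t y.-1 y).
by rewrite (wave_far P (leqnn y) ltac:(arith)) kept_stable //; lra.
Qed.

Lemma wave_loaded_step x y : (x < y)%N ->
  (3 * t.+1 + 6 = 5 * y + x \/ 3 * t.+1 + 3 = 5 * y + x)%N ->
  27 / 28 <= c t.+1 x y /\ c t.+1 x y < 1.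
Proof.
have bx := backP x.
move=> xy [] ty; last first.
  have [lo hi] := @wave_loaded _ P x y xy ltac:(arith).
  by rewrite quadrant_off_parity_step //; [rewrite kept_stable | arith].
rewrite quadrant_inside //.
silent (c t x.+1 y); silent (c t (back x) y); silent (c t x y.+1).
have [lo hi lox] := @wave_m4 _ P x y.-1 ltac:(arith) ltac:(arith).
rewrite (wave_far P (ltnW xy) ltac:(arith)) kept_stable // emitted_unstable; last by lra.
by split; range.
Qed.

Lemma wave_m4_step x y : (x <= y)%N -> (3 * t.+1 + 4 = 5 * y + x)%N ->
  [/\ 1 <= c t.+1 x y, c t.+1 x y < 4 - 4 * h
    & (0 < x)%N -> 29 / 28 <= c t.+1 x y].
Proof.
have bx := backP x.
move=> xy ty; rewrite quadrant_inside; last by arith.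
silent (c t x.+1 y); silent (c t (back x) y); silent (c t x y.+1).
have [lo hi lox] := @wave_m2 _ P x y.-1 ltac:(arith) ltac:(arith).
rewrite (wave_far P xy ltac:(arith)) kept_stable // emitted_unstable; last by lra.
by split=> [||/lox]; range.
Qed.

Lemma wave_m2_step x y : (x <= y)%N -> (3 * t.+1 + 2 = 5 * y + x)%N ->
  [/\ 8 / 7 <= c t.+1 x y, c t.+1 x y < 16 - 20 * h
    & (0 < x)%N -> 73 / 56 <= c t.+1 x y].
Proof.
have bx := backP x.
move=> xy ty; rewrite quadrant_inside; last by arith.
silent (c t x.+1 y); silent (c t x y.+1).
rewrite (wave_far P xy ltac:(arith)) kept_stable //.
have [y1|y1] := leqP y 1.
  have [t0 [x0 y1E]] : t = 0%N /\ x = 0%N /\ y = 1%N by arith.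
  rewrite t0 x0 y1E /= start_origin start_outside // (emitted_stable h1).
  rewrite emitted_unstable; last by lra.
  by split; range.
have [lo0 hi0 lo0l lo0i] := @wave_0 _ P x y.-1 ltac:(arith) ltac:(arith) ltac:(arith).
rewrite (@emitted_unstable _ (c t x y.-1)); last by lra.
have [x0|x0] := posnP x.
  silent (c t (back x) y).
  have {}lo0l := lo0l ltac:(arith).
  by split=> [||x00]; [range | range | arith].
have [lo4 hi4 lo4i] := @wave_m4 _ P (back x) y ltac:(arith) ltac:(arith).
rewrite (@emitted_unstable _ (c t (back x) y)); last by lra.
by split=> [||_]; range.
Qed.

(** Phase 0 keeps what it held at phase -3. The corner [(1, 1)] is the only one whose
    neighbour lies on the axis; its value is taken from the explicit first steps. *)
Lemma wave_0_step x y : (x <= y)%N -> (0 < y)%N -> (3 * t.+1 = 5 * y + x)%N ->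
  [/\ 19 / 14 <= c t.+1 x y, c t.+1 x y <= 20 / 9,
      (x < y)%N -> 97 / 56 <= c t.+1 x y
    & (0 < x < y)%N -> 99 / 56 <= c t.+1 x y].
Proof.
have bx := backP x.
rewrite leq_eqVlt => /orP[/eqP yx|xy] y0 ty.
  rewrite yx ltnn andbF.
  suff [lo hi] : 19 / 14 <= c t.+1 y y /\ c t.+1 y y <= 20 / 9 by [].
  have [lo2 hi2 lo2i] := @wave_m2 _ P y.-1 y ltac:(arith) ltac:(arith).
  have e : c t.+1 y y = h + c t y.-1 y / 2.
    rewrite quadrant_diagonal //; silent (c t y y.+1).
    rewrite (@wave_corner _ P y) ?kept_stable // ?emitted_unstable ?add0r //; last by arith.
    by lra.
  split; last by rewrite e; range.
  have [y1|y1] := leqP y 1; last by have := lo2i ltac:(arith); rewrite e; range.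
  have [-> ->] : t = 1%N /\ y = 1%N by arith.
  by have [] := wave_start; lra.
rewrite quadrant_inside //; silent (c t x y.+1).
have [lol hil] := @wave_loaded _ P x y xy ltac:(arith).
rewrite (kept_stable hil).
have [lo4 hi4 /(_ isT) lo4i] := @wave_m4 _ P x.+1 y xy ltac:(arith).
rewrite (@emitted_unstable _ (c t x.+1 y)); last by lra.
have [lo2 hi2 lo2i] := @wave_2 _ P x y.-1 ltac:(arith) ltac:(arith).
rewrite (@emitted_unstable _ (c t x y.-1)); last by lra.
have [x0|x0] := posnP x.
  have -> : back x = x.+1 by rewrite x0.
  rewrite (@emitted_unstable _ (c t x.+1 y)); last by lra.
  by split=> [|||/andP[]]; [range | range | range | arith].
have {}lo2i := lo2i x0.
have [lom him _] := @wave_m2 _ P (back x) y ltac:(arith) ltac:(arith).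
rewrite (@emitted_unstable _ (c t (back x) y)); last by lra.
by split; range.
Qed.

Lemma wave_2_step x y : (x <= y)%N -> (3 * t.+1 = 5 * y + x + 2)%N ->
  [/\ 1 <= c t.+1 x y, c t.+1 x y <= 2
    & (0 < x)%N -> 29 / 28 <= c t.+1 x y].
Proof.
have bx := backP x.
move=> xy ty.
have [lo2 hi2 /(_ isT) lo2i] := @wave_m2 _ P x.+1 y ltac:(arith) ltac:(arith).
have [lo4 lo4a] := @wave_4 _ P x y.-1 ltac:(arith) ltac:(arith).
have le3 := @wave_all_le3 x y.-1 ltac:(arith).
have hole := wave_hole P xy ltac:(arith) ltac:(arith).
have E : c t.+1 x y = (c t x.+1 y + emitted (c t (back x) y) + c t x y.-1) / 4.
  rewrite quadrant_inside; last by arith.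
  rewrite hole kept_stable ?ltr01 //; silent (c t x y.+1).
  rewrite (@emitted_unstable _ (c t x.+1 y)) ?(@emitted_unstable _ (c t x y.-1)); lra.
have [x0|x0] := posnP x.
  have EE : c t.+1 x y = (2 * c t x.+1 y + c t x y.-1) / 4.
    rewrite E; have -> : back x = x.+1 by rewrite x0.
    by rewrite emitted_unstable; lra.
  have x00 : (0 < x)%N -> 29 / 28 <= c t.+1 x y by arith.
  split=> //; last by rewrite EE; range.
  have [y2|y2] := leqP y 2; last by have := lo4a x0 ltac:(arith); rewrite EE; lra.
  have [-> [-> ->]] : t = 3%N /\ x = 0%N /\ y = 2%N by arith.
  by have [] := wave_start; lra.
have [lo0 hi0 lo0l lo0i] := @wave_0 _ P (back x) y ltac:(arith) ltac:(arith) ltac:(arith).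
have := lo0l ltac:(arith).
rewrite E emitted_unstable; last by lra.
by split; range.
Qed.

Lemma wave_4_step x y : (x <= y)%N -> (3 * t.+1 = 5 * y + x + 4)%N ->
  31 / 28 <= c t.+1 x y /\
  (x = 0%N -> (1 < y)%N -> 39 / 28 <= c t.+1 x y).
Proof.
have bx := backP x.
move=> xy ty.
have [y1|y1] := leqP y 1.
  have [-> [-> ->]] : t = 2%N /\ x = 0%N /\ y = 1%N by arith.
  by have [] := wave_start; split; lra.
have hole := wave_hole P xy ltac:(arith) ltac:(arith).
have [lo0 hi0 lo0l lo0i] := @wave_0 _ P x.+1 y ltac:(arith) ltac:(arith) ltac:(arith).
have [lo4 hi4 lo4i] := @wave_m4 _ P x y.+1 ltac:(arith) ltac:(arith).
have lo6 := @wave_6 _ P x y.-1 ltac:(arith) ltac:(arith).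
have E : c t.+1 x y =
    (c t x.+1 y + emitted (c t (back x) y) + c t x y.+1 + c t x y.-1) / 4.
  rewrite quadrant_inside; last by arith.
  rewrite hole kept_stable ?ltr01 //.
  rewrite (@emitted_unstable _ (c t x.+1 y)); last by lra.
  rewrite (@emitted_unstable _ (c t x y.+1)); last by lra.
  by rewrite (@emitted_unstable _ (c t x y.-1)); lra.
have [x0|x0] := posnP x.
  have := lo0i ltac:(arith); rewrite E.
  have -> : back x = x.+1 by rewrite x0.
  by rewrite emitted_unstable; [split; lra | lra].
have [lo2 hi2 lo2i] := @wave_2 _ P (back x) y ltac:(arith) ltac:(arith).
rewrite E emitted_unstable; last by lra.
by split=> [|x00]; [have := lo4i x0; lra | arith].
Qed.

Lemma wave_6_step x y : (x <= y)%N -> (3 * t.+1 = 5 * y + x + 6)%N ->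
  59 / 56 <= c t.+1 x y.
Proof.
have bx := backP x.
move=> xy ty.
have hole := wave_hole P xy ltac:(arith) ltac:(arith).
have [lom him lomi] := @wave_m2 _ P x y.+1 ltac:(arith) ltac:(arith).
move: xy; rewrite leq_eqVlt => /orP[/eqP yx|xy].
  move: hole lom lomi; rewrite yx => hole lom lomi.
  have [y0|y0] := posnP y.
    move: hole lom; rewrite y0 => hole lom.
    by rewrite quadrant_origin hole kept_stable ?ltr01 // emitted_unstable; lra.
  have [lo4 _] := @wave_4 _ P y.-1 y ltac:(arith) ltac:(arith).
  rewrite quadrant_diagonal // hole kept_stable ?ltr01 //.
  by rewrite !emitted_unstable //; lra.
rewrite quadrant_inside // hole kept_stable ?ltr01 //.
rewrite (@emitted_unstable _ (c t x y.+1)); last by lra.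
have lo8 := @wave_8 _ P x y.-1 ltac:(arith) ltac:(arith) ltac:(arith).
rewrite (@emitted_unstable _ (c t x y.-1)) //.
have [lo2 hi2 /(_ isT) lo2i] := @wave_2 _ P x.+1 y ltac:(arith) ltac:(arith).
rewrite (@emitted_unstable _ (c t x.+1 y)); last by lra.
have [x0|x0] := posnP x.
  have -> : back x = x.+1 by rewrite x0.
  by rewrite emitted_unstable; lra.
have [lo4 _] := @wave_4 _ P (back x) y ltac:(arith) ltac:(arith).
have := lomi x0.
by rewrite emitted_unstable; lra.
Qed.

(** An empty site that receives from four unstable neighbours holds at least
    [4 * 1 / 4 = 1]. *)
Lemma wave_8_step x y : (x <= y)%N -> (5 * y + x + 8 <= 3 * t.+1)%N ->
  ~~ odd (t.+1 + x + y) -> 1 <= c t.+1 x y.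
Proof.
have bx := backP x.
move=> xy ty oxy.
have hole := wave_hole P xy ltac:(arith) ltac:(arith).
have up := @wave_unstable x y.+1 ltac:(arith) ltac:(arith) ltac:(arith).
move: xy; rewrite leq_eqVlt => /orP[/eqP yx|xy].
  move: hole up; rewrite yx => hole up.
  have [y0|y0] := posnP y.
    move: hole up; rewrite y0 => hole up.
    by rewrite quadrant_origin hole kept_stable ?ltr01 // emitted_unstable // add0r.
  have lo := @wave_unstable y.-1 y ltac:(arith) ltac:(arith) ltac:(arith).
  rewrite quadrant_diagonal // hole kept_stable ?ltr01 //.
  by rewrite !emitted_unstable //; lra.
rewrite quadrant_inside // hole kept_stable ?ltr01 //.
have lo1 := @wave_unstable x.+1 y ltac:(arith) ltac:(arith) ltac:(arith).
have lo2 := @wave_unstable (back x) y ltac:(arith) ltac:(arith) ltac:(arith).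
have lo3 := @wave_unstable x y.-1 ltac:(arith) ltac:(arith) ltac:(arith).
by rewrite !emitted_unstable //; lra.
Qed.

Lemma wave_hole_step x y : (x <= y)%N -> (5 * y + x <= 3 * t.+1 + 1)%N ->
  odd (t.+1 + x + y) -> c t.+1 x y = 0.
Proof.
move=> xy ty oxy; apply: quadrant_after_split => //.
by apply: wave_unstable; arith.
Qed.

Lemma wave_le3_step x y : (x <= y)%N -> (5 * y + x + 4 <= 3 * t.+1)%N ->
  c t.+1 x y <= 3.
Proof.
have bx := backP x.
move=> xy ty.
have [oxy|oxy] := boolP (odd (t.+1 + x + y)).
  by have := @quadrant_off_parity _ 3 _ h1 _ _ _ oxy; lra.
have hole := wave_hole P xy ltac:(arith) ltac:(arith).
have le3 u v : (u <= v)%N -> emitted (c t u v) <= 3.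
  by move=> uv; apply: emitted_le; [lra | exact: wave_all_le3].
have up := le3 x y.+1 ltac:(arith).
move: xy; rewrite leq_eqVlt => /orP[/eqP yx|xy].
  move: hole up; rewrite yx => hole up.
  have [y0|y0] := posnP y.
    by move: hole up; rewrite y0 quadrant_origin => -> up; rewrite kept_stable ?ltr01 // add0r.
  have lo := le3 y.-1 y ltac:(arith).
  by rewrite quadrant_diagonal // hole kept_stable ?ltr01 //; lra.
rewrite quadrant_inside // hole kept_stable ?ltr01 //.
have lo1 := le3 x.+1 y ltac:(arith).
have lo2 := le3 (back x) y ltac:(arith).
have lo3 := le3 x y.-1 ltac:(arith).
by lra.
Qed.

Lemma wave_step : wave t.+1.
Proof.
split; [exact: wave_far_step | exact: wave_corner_step | exact: wave_loaded_step
  | exact: wave_m4_step | exact: wave_m2_step | exact: wave_0_step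
  | exact: wave_2_step | exact: wave_4_step | exact: wave_6_step
  | exact: wave_8_step | exact: wave_hole_step | exact: wave_le3_step].
Qed.

End Step.

Lemma waveT t : wave t.
Proof. by elim: t => [|t IH]; [exact: wave_start0 | exact: wave_step]. Qed.

End OctagonWave.

(** * Gauges of the square and of the octagon *)

Section Plane.
Variable R : realType.
Implicit Types (x y : 'rV[R]_2) (B : set 'rV[R]_2).

Lemma point2_eta x : x = point2 (x 0 0) (x 0 1).
Proof.
apply/rowP => i; rewrite mxE; case: (unliftP ord0 i) => [j ->|-> //].
by rewrite (ord1 j) /=; congr (x _ _); apply: val_inj.
Qed.

Lemma point2_comb (r s a b a' b' : R) :
  r *: point2 a b + s *: point2 a' b' = point2 (r * a + s * a') (r * b + s * b').
Proof.
apply/rowP => i; rewrite !mxE; case: (unliftP ord0 i) => [j ->|-> //].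
by rewrite (ord1 j).
Qed.

Lemma point2_0 (a b : R) : point2 a b 0 0 = a. Proof. by rewrite mxE. Qed.
Lemma point2_1 (a b : R) : point2 a b 0 1 = b. Proof. by rewrite mxE. Qed.

Lemma convex_segment B x y (l : R) : @convex_set R 'rV[R]_2 B ->
  B x -> B y -> 0 <= l -> l <= 1 -> B (l *: x + (1 - l) *: y).
Proof.
move=> cB Bx By l0 l1.
have := cB x y (Itv01 l0 l1); rewrite !inE => H.
exact: H.
Qed.

(** The combination is a point of the segment from [p] to [q], scaled towards 0. *)
Lemma convex_triangle B p q (r s : R) : @convex_set R 'rV[R]_2 B ->
  B 0 -> B p -> B q -> 0 <= r -> 0 <= s -> r + s <= 1 -> B (r *: p + s *: q).
Proof.
move=> cB B0 Bp Bq r0 s0 rs1.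
have [rs|rs] := eqVneq (r + s) 0.
  have [-> ->] : r = 0 /\ s = 0 by split; lra.
  by rewrite !scale0r addr0.
have rs0 : 0 < r + s by rewrite lt_neqAle eq_sym rs addr_ge0.
have rE : (r + s) * (r / (r + s)) = r by rewrite mulrC divfK.
have sE : (r + s) * (1 - r / (r + s)) = s by rewrite mulrBr rE; lra.
have -> : r *: p + s *: q =
    (r + s) *: (r / (r + s) *: p + (1 - r / (r + s)) *: q) + (1 - (r + s)) *: 0.
  by rewrite scaler0 addr0 scalerDr !scalerA rE sE.
apply: convex_segment => //; first apply: convex_segment => //.
- by rewrite divr_ge0 // ltW.
- by rewrite ler_pdivrMr // mul1r lerDl.
- exact: ltW.
Qed.

Definition sup_gauge x : R := Num.max `|x 0 0| `|x 0 1|.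

Definition octagon_gauge x : R :=
  Num.max (`|x 0 0| + `|x 0 1| / 5) (`|x 0 1| + `|x 0 0| / 5).

Lemma maxr_le_add (a b c d : R) : Num.max (a + c) (b + d) <= Num.max a b + Num.max c d.
Proof. by rewrite ge_max !lerD // le_max lexx ?orbT. Qed.

Lemma sup_gaugeZ s x : 0 <= s -> sup_gauge (s *: x) = s * sup_gauge x.
Proof. by move=> s0; rewrite /sup_gauge !mxE !normrM ger0_norm // maxr_pMr. Qed.

Lemma sup_gaugeD x y : sup_gauge (x + y) <= sup_gauge x + sup_gauge y.
Proof.
apply: le_trans (maxr_le_add _ _ _ _); rewrite /sup_gauge !mxE ge_max.
by rewrite !le_max !ler_normD ?orbT.
Qed.

Lemma coord_le_sup_gauge x (i : 'I_2) : `|x 0 i| <= sup_gauge x.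
Proof.
rewrite /sup_gauge; case: (unliftP ord0 i) => [j ->|->]; last by rewrite le_max lexx.
have -> : lift ord0 j = 1 by rewrite (ord1 j); apply: val_inj.
by rewrite le_max lexx orbT.
Qed.

Lemma sup_gauge_cube x : unit_cube x -> sup_gauge x <= 1.
Proof. by move=> cx; rewrite ge_max; apply/andP; split; apply: le_trans (cx _) _; lra. Qed.

Lemma octagon_gaugeZ s x : 0 <= s -> octagon_gauge (s *: x) = s * octagon_gauge x.
Proof.
move=> s0; rewrite /octagon_gauge !mxE !normrM ger0_norm //.
by rewrite -!mulrA -!mulrDr maxr_pMr.
Qed.

Lemma octagon_gaugeD x y : octagon_gauge (x + y) <= octagon_gauge x + octagon_gauge y.
Proof.
apply: le_trans (maxr_le_add _ _ _ _); rewrite /octagon_gauge !mxE ge_max !le_max.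
have n0 := ler_normD (x 0 0) (y 0 0); have n1 := ler_normD (x 0 1) (y 0 1).
by apply/andP; split; apply/orP; [left | right]; lra.
Qed.

Lemma coord_le_octagon_gauge x (i : 'I_2) : `|x 0 i| <= octagon_gauge x.
Proof.
apply: (le_trans (coord_le_sup_gauge x i)); rewrite ge_max /octagon_gauge !le_max.
have := normr_ge0 (x 0 0); have := normr_ge0 (x 0 1) => ? ?.
by apply/andP; split; apply/orP; [left | right]; lra.
Qed.

Lemma octagon_gauge_cube x : unit_cube x -> octagon_gauge x <= 1.
Proof.
move=> cx; have := cx 0; have := cx 1 => ? ?.
by rewrite ge_max; apply/andP; split; lra.
Qed.

Lemma convex_sublevel (N : 'rV[R]_2 -> R) :
  (forall s x, 0 <= s -> N (s *: x) = s * N x) ->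
  (forall x y, N (x + y) <= N x + N y) ->
  @convex_set R 'rV[R]_2 [set x | N x <= 1].
Proof.
move=> scN addN x y l; rewrite !inE => Nx Ny.
change (N (l%:num *: (x : 'rV[R]_2) + (1 - l%:num) *: (y : 'rV[R]_2)) <= 1).
have l0 : 0 <= l%:num by [].
have l1 : 0 <= 1 - l%:num by rewrite subr_ge0.
apply: (le_trans (addN _ _)); rewrite !scN //.
have : l%:num * N x <= l%:num * 1 by rewrite ler_wpM2l.
have : (1 - l%:num) * N y <= (1 - l%:num) * 1 by rewrite ler_wpM2l.
lra.
Qed.

(** The sublevel set is convex and contains the vertices. Conversely the axes and the
    diagonals cut the octagon into eight triangles with a vertex at the origin, and
    in each of them a point is an explicit combination of the two other vertices. *)
Lemma octagon_gaugeE : octagon R = [set x | octagon_gauge x <= 1].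
Proof.
apply/seteqP; split.
  apply: smallest_sub => [|x].
    by apply: convex_sublevel => *; [exact: octagon_gaugeZ | exact: octagon_gaugeD].
  have p56 : `|5 / 6| = 5 / 6 :> R by rewrite ger0_norm //; lra.
  rewrite /octagon_vertices /octagon_gauge /= => -[[[[[[[]|]|]|]|]|]|] ->;
    rewrite !point2_0 !point2_1 ?normrN ?normr1 ?normr0 ?p56 ge_max;
    apply/andP; split; lra.
move=> x; rewrite /= /octagon_gauge ge_max => /andP[g0 g1] B [cB VB].
have vx (s : bool) : B (point2 ((-1) ^+ s) 0).
  by apply: VB; rewrite /octagon_vertices /=; case: s; rewrite ?expr1 ?expr0; tauto.
have vy (s : bool) : B (point2 0 ((-1) ^+ s)).
  by apply: VB; rewrite /octagon_vertices /=; case: s; rewrite ?expr1 ?expr0; tauto.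
have vd (s s' : bool) : B (point2 ((-1) ^+ s * (5 / 6)) ((-1) ^+ s' * (5 / 6))).
  apply: VB; rewrite /octagon_vertices /=; case: s s' => -[];
    rewrite ?expr1 ?expr0 ?mulN1r ?mul1r; tauto.
have B0 : B 0.
  have := convex_segment cB (vx true) (vx false) (l := 1 / 2) ltac:(lra) ltac:(lra).
  rewrite point2_comb expr1 expr0; have -> : (1 / 2 * -1 + (1 - 1 / 2) * 1 : R) = 0 by lra.
  rewrite !mulr0 addr0 [in X in _ -> X](point2_eta 0) !mxE //.
have sector (s s' : bool) (a b : R) : 0 <= a -> 0 <= b ->
    a + b / 5 <= 1 -> b + a / 5 <= 1 -> B (point2 ((-1) ^+ s * a) ((-1) ^+ s' * b)).
  move: (vx s) (vy s') (vd s s') => {vx vy vd VB x g0 g1}.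
  move: ((-1) ^+ s) ((-1) ^+ s') => p q {s s'} vx vy vd a0 b0 g0 g1.
  have [ab|ba] := lerP a b.
    have -> : point2 (p * a) (q * b) =
        (b - a) *: point2 0 q + (6 / 5 * a) *: point2 (p * (5 / 6)) (q * (5 / 6)).
      by rewrite point2_comb; congr point2; field.
    by apply: convex_triangle => //; lra.
  have -> : point2 (p * a) (q * b) =
      (a - b) *: point2 p 0 + (6 / 5 * b) *: point2 (p * (5 / 6)) (q * (5 / 6)).
    by rewrite point2_comb; congr point2; field.
  by apply: convex_triangle => //; lra.
rewrite (point2_eta x) (numEsign (x 0 0)) (numEsign (x 0 1)).
exact: sector.
Qed.

End Plane.

(** * Limiting shapes in the plane *)

Section PlanarShapes.
Variable R : realType.
Implicit Types (n h : R).

Lemma ever_split_octant n h t (v : 'rV[int]_2) :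
  ever_split n h t v <->
  exists2 s, (s < t)%N
    & 1 <= quadrant n h s (minn `|v 0%R 0%R| `|v 0%R 1%R|)
                          (maxn `|v 0%R 0%R| `|v 0%R 1%R|).
Proof.
have E s : configuration n h s v =
    quadrant n h s (minn `|v 0%R 0%R| `|v 0%R 1%R|) (maxn `|v 0%R 0%R| `|v 0%R 1%R|).
  rewrite configuration_quadrant /minn /maxn; case: ltnP => // _.
  exact: quadrantC.
split=> [/ever_splitP[s st sv]|[s st sv]]; first by exists s; rewrite -?E.
by apply/ever_splitP; exists s; rewrite ?E.
Qed.

Lemma norm_intr (v : 'rV[int]_2) i :
  `|(map_mx intr v : 'rV[R]_2) 0 i| = (absz (v 0 i))%:R.
Proof. by rewrite mxE natr_absz -intr_norm. Qed.

Lemma sup_gauge_intr (v : 'rV[int]_2) :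
  sup_gauge (map_mx intr v) = (maxn `|v 0%R 0%R| `|v 0%R 1%R|)%:R :> R.
Proof. by rewrite /sup_gauge !norm_intr natr_max. Qed.

Lemma octagon_gauge_intr (v : 'rV[int]_2) :
  octagon_gauge (map_mx intr v) =
  (maxn `|v 0%R 0%R| `|v 0%R 1%R|)%:R + (minn `|v 0%R 0%R| `|v 0%R 1%R|)%:R / 5 :> R.
Proof.
rewrite /octagon_gauge !norm_intr /maxn /minn.
case: ltnP; rewrite -(ler_nat R) -?(ltr_nat R) => le; [apply: max_r | apply: max_l]; lra.
Qed.

(** Only the first splitting time of each site matters, within two steps of [2y] where
    [y] is the larger coordinate. *)
Lemma square_limiting_shape n h :
  (forall s x y, (x <= y)%N -> (s + 4 <= 2 * y)%N -> quadrant n h s x y < 1) ->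
  (forall x y, (x <= y)%N ->
     exists2 s, (s <= 2 * y + 2)%N & 1 <= quadrant n h s x y) ->
  automaton_limiting_shape n h (fun t : nat => 2 / t%:R) (square R).
Proof.
move=> late early; rewrite /automaton_limiting_shape.
rewrite -[square R]/[set x | sup_gauge x <= 1].
apply: (@limiting_shape_gauge R 2 (@sup_gauge R) (1 / 2) 2 1 (ever_split n h)); try lra.
- exact: sup_gaugeZ.
- exact: sup_gaugeD.
- exact: coord_le_sup_gauge.
- exact: sup_gauge_cube.
- exists (point2 1 0), 0; rewrite /sup_gauge point2_0 point2_1 normr1 normr0.
  by rewrite ge_max lexx ler01.
- move=> t v t0 /ever_split_octant[s st sv]; rewrite sup_gauge_intr.
  set m := maxn _ _ in sv *.
  have ms : (2 * m < s + 4)%N.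
    rewrite ltnNge; apply/negP => sm.
    by move: sv; rewrite leNgt late //; lia.
  have : (2 * m <= t + 2)%N by lia.
  by rewrite -(ler_nat R) natrM natrD; lra.
- move=> t v t0; rewrite sup_gauge_intr => vt; apply/ever_split_octant.
  have [|s sm sv] := early (minn `|v 0%R 0%R| `|v 0%R 1%R|) (maxn `|v 0%R 0%R| `|v 0%R 1%R|).
    by lia.
  exists s => //; apply: (leq_ltn_trans sm).
  have : (2 * maxn `|v 0%R 0%R| `|v 0%R 1%R| + 4)%:R <= t%:R :> R.
    by rewrite natrD natrM; lra.
  by rewrite ler_nat; lia.
- move=> t t0; rewrite -[t%:R in RHS]mulr1; field.
  by rewrite pnatr_eq0 -lt0n.
Qed.

Lemma square_even_phase n h : 7 / 10 <= h -> h < 40 / 57 ->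
  4 - 4 * h <= n -> n < 16 - 20 * h ->
  automaton_limiting_shape n h (fun t : nat => 2 / t%:R) (square R).
Proof.
move=> h_lo h_hi n_lo n_hi; have P := even_profileT h_lo h_hi n_lo n_hi.
apply: square_limiting_shape => [s x y xy sy|x y xy].
  by apply: (even_untouched h_lo h_hi n_lo n_hi (P s)) => //; lia.
have [oxy|oxy] := boolP (odd (x + y)).
  exists (2 * y).-1; first by lia.
  by have /andP[] := @even_first _ _ _ _ (P (2 * y).-1) x y xy ltac:(lia) oxy.
exists (2 * y)%N; first by lia.
by have /andP[lo _] := @even_second _ _ _ _ (P (2 * y)%N) x y xy erefl oxy; lra.
Qed.

Lemma square_odd_phase n h : 7 / 10 <= h -> h < 40 / 57 -> n = 16 - 20 * h ->
  automaton_limiting_shape n h (fun t : nat => 2 / t%:R) (square R).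
Proof.
move=> h_lo h_hi nE; have P := odd_profileT h_lo h_hi nE.
have h1 : h < 1 by lra.
apply: square_limiting_shape => [[|s] x y xy sy|x y xy].
- by rewrite /=; case: y xy sy => // y xy sy; rewrite andbF.
- by apply: (odd_untouched h_lo h_hi nE (P s)) => //; lia.
have [y0|y0] := posnP y.
  have [-> ->] : x = 0%N /\ y = 0%N by lia.
  by exists 0%N => //=; lra.
have [oxy|oxy] := boolP (odd (x + y)).
  exists (2 * y).-2.+1; first by lia.
  by have /andP[] := @odd_second _ _ _ _ (P (2 * y).-2) x y xy ltac:(lia) oxy; lra.
have [xyE|xyE] := eqVneq x y.
  exists (2 * y).-1.+1; first by lia.
  rewrite xyE.
  by have /andP[] := @odd_third_corner _ _ _ _ (P (2 * y).-1) y y0 ltac:(lia); lra.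
exists (2 * y - 3)%N.+1; first by lia.
by have /andP[] := @odd_first _ _ _ _ (P (2 * y - 3)%N) x y ltac:(lia) ltac:(lia) oxy.
Qed.

(** A site of phase at least -4 is unstable at one of any two consecutive times, the one
    of the right parity. *)
Lemma octagon_limiting_shape h : 5 / 7 <= h -> h < 13 / 18 ->
  automaton_limiting_shape 3 h (fun t : nat => 5 / (3 * t%:R)) (octagon R).
Proof.
move=> h_lo h_hi; have P := waveT h_lo h_hi.
rewrite /automaton_limiting_shape octagon_gaugeE.
apply: (@limiting_shape_gauge R 2 (@octagon_gauge R) (3 / 5) 2 1 (ever_split 3 h));
  try lra.
- exact: octagon_gaugeZ.
- exact: octagon_gaugeD.
- exact: coord_le_octagon_gauge.
- exact: octagon_gauge_cube.
- exists (point2 1 0), 0; rewrite /octagon_gauge point2_0 point2_1 normr1 normr0.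
  by split=> //; rewrite ge_max; apply/andP; split; lra.
- move=> t v t0 /ever_split_octant[s st sv]; rewrite octagon_gauge_intr.
  move: sv; set m := minn _ _; set M := maxn _ _ => sv.
  have mM : (m <= M)%N by lia.
  have ms : (5 * M + m < 3 * s + 5)%N.
    rewrite ltnNge; apply/negP => sm.
    by move: sv; rewrite leNgt (wave_untouched h_lo h_hi (P s)).
  have : (5 * M + m <= 3 * t + 1)%N by lia.
  by rewrite -(ler_nat R) 2!natrD 2!natrM; lra.
- move=> t v t0; rewrite octagon_gauge_intr => vt; apply/ever_split_octant.
  move: vt; set m := minn _ _; set M := maxn _ _ => vt.
  have mM : (m <= M)%N by lia.
  have mt : (5 * M + m + 10 <= 3 * t)%N.
    by rewrite -(ler_nat R) 2!natrD 2!natrM; lra.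
  have [s [st ts os]] : exists s, [/\ (s < t)%N, (t <= s + 2)%N & ~~ odd (s + m + M)].
    case: (boolP (odd (t + m + M))) => o; [exists t.-1 | exists t.-2]; split; lia.
  by exists s => //; apply: (wave_unstable (P s)) => //; lia.
- by move=> t t0; field; rewrite pnatr_eq0 -lt0n.
Qed.

End PlanarShapes.

Theorem theorem3p1 (R : realType) :
  (forall d : nat, (1 <= d)%N ->
     forall h n : R, 1 - 1 / (2 * d)%:R <= h -> h < 1 -> 1 <= n ->
     automaton_limiting_shape n h (fun t : nat => 1 / t%:R) (diamond R d))
  /\
  (forall h n : R, 7 / 10 <= h -> h < 40 / 57 ->
     4 - 4 * h <= n -> n <= 16 - 20 * h ->
     automaton_limiting_shape n h (fun t : nat => 2 / t%:R) (square R))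
  /\
  (forall h : R, 5 / 7 <= h -> h < 13 / 18 ->
     automaton_limiting_shape 3 h (fun t : nat => 5 / (3 * t%:R)) (octagon R)).
Proof.
split; [|split].
- by move=> d d1 h n; exact: diamond_limiting_shape.
- move=> h n h_lo h_hi n_lo n_hi; have [n_lt|n_ge] := ltrP n (16 - 20 * h).
    exact: square_even_phase.
  by apply: square_odd_phase => //; apply/le_anti/andP.
- by move=> h; exact: octagon_limiting_shape.
Qed.
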